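(* For each $m>0$: (1) symmetric universal Maurer-Cartan elements of length $m$ exist; (2) any two universal Maurer-Cartan elements of length $m$ (symmetric or not) are strongly gauge equivalent, and any two strong gauge equivalences between them are homotopic.
   Context: Over $\mathbb{R}$, let $\Omega=\bigoplus_{k\ge1,l}\Omega^k(l)$ be the bigraded vector space where $\Omega^{k}$ has as basis the words of length $k-1$ in the letters $a,b,c$; the empty word $e$ spans $\Omega^1$; a word in which $b$ occurs $r$ times has $l=-r$. Let $\diamond$ be concatenation. Structure maps: $w\circ w'=w\diamond c\diamond w'$; $d_i(e_1\cdots e_{k-1})=e_1\cdots e_{i-1}\,a\,e_i\cdots e_{k-1}$ for $1\le i\le k$ on $\Omega^k$; $\partial$ is the linear map with $\partial e=\partial a=\partial c=0$, $\partial b=c-a$, $\partial(w\diamond w')=\partial(w)\diamond w'+(-1)^{l(w)}w\diamond\partial(w')$. $\Omega_m=\Omega\boxtimes\cdots\boxtimes\Omega$ ($m$ factors), where $(\mathcal{A}\boxtimes\mathcal{B})^k(l)=\bigoplus_{i+j=l}\mathcal{A}^k(i)\otimes\mathcal{B}^k(j)$ with $\partial(a\boxtimes b)=\partial a\boxtimes b+(-1)^{l(a)}a\boxtimes\partial b$, $d_i(a\boxtimes b)=d_ia\boxtimes d_ib$, $(a\boxtimes b)\circ(a'\boxtimes b')=(-1)^{l(b)l(a')}(a\circ a')\boxtimes(b\circ b')$. $\bar\Omega_m$ is the DGA with $\bar\Omega_m^n=\prod_{k+l=n}\Omega_m^k(l)$, product $a\star b=(-1)^{k(a)|b|}a\circ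 b$ ($|b|=k(b)+l(b)$), differential $d_{\mathrm{tot}}=\partial+(-1)^n\sum_{i=1}^k(-1)^id_i$ on elements of total degree $n$ in $\Omega_m^k$. A universal Maurer-Cartan element of length $m$ is $\omega=\omega_1+\omega_2+\cdots\in\bar\Omega_m^1$ ($\omega_k\in\Omega_m^k(1-k)$) with $d_{\mathrm{tot}}\omega+\omega\star\omega=0$ and $\omega_1=e^{\boxtimes m}$. $S_m$ acts on $\Omega_m$ by $\sigma\mapsto\hat\sigma$, where the transposition of positions $i,i+1$ sends $a_1\boxtimes\cdots\boxtimes a_m$ to $(-1)^{l(a_i)l(a_{i+1})}a_1\boxtimes\cdots\boxtimes a_{i+1}\boxtimes a_i\boxtimes\cdots\boxtimes a_m$. $\omega$ is symmetric if $\hat\sigma(\omega)=\omega$ for all $\sigma\in S_m$. A strong gauge equivalence between $\omega$ and $\theta$ is an element $u=1+\alpha$, $\alpha\in\bar\Omega_m^0$, of the DGA obtained by formally adjoining a unit $1$ to $\bar\Omega_m$ (such $u$ is invertible), satisfying $u\star\omega\star u^{-1}-\theta=(d_{\mathrm{tot}}u)\star u^{-1}$. Two such $u,u'$ are homotopic if there is $h\in\bar\Omega_m^{-1}$ with $u-u'=d_{\mathrm{tot}}h+h\star\omega+\theta\star h$. *)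

(* Defs.v *)
From HB Require Import structures.
From mathcomp Require Import all_boot all_order all_algebra all_fingroup.
From mathcomp Require Import boolp reals zify.

Set Implicit Arguments.
Unset Strict Implicit.
Unset Printing Implicit Defensive.

Import Order.TTheory GRing.Theory Num.Theory.

Local Open Scope ring_scope.

(* Free vector spaces on finite sets.  Since every space Omega_m^k comes with a
   finite basis, the tensor product of two of them is the free vector space on
   the product of the bases. *)

Definition Vec (R : realType) (T : finType) := {ffun T -> R^o}.

Definition delta (R : realType) (T : finType) (v : T) : Vec R T :=
  [ffun t => (t == v)%:R].

Definition linext (R : realType) (S T : finType) (f : S -> Vec R T)
    (x : Vec R S) : Vec R T :=
  \sum_v x v *: f v.

Definition bilext (R : realType) (S S' T : finType) (f : S -> S' -> Vec R T)
    (x : Vec R S) (y : Vec R S') : Vec R T :=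
  \sum_v \sum_w (x v * y w) *: f v w.

(* x (x) y, where T x T^n is identified with T^(n+1).  For T the set of letters
   this is the concatenation of a combination of letters with a combination of
   words; for T the set of words it is the product x [x] y with x in Omega and
   y in Omega_n. *)
Definition tens (R : realType) (T : finType) n (x : Vec R T)
    (y : Vec R (n.-tuple T)) : Vec R (n.+1.-tuple T) :=
  [ffun t => x (thead t) * y (behead_tuple t)].

(* The graded Leibniz rule extending f to T^n:
   D (s (x) t) = f s (x) t + (-1)^(l s) s (x) D t,  with D = 0 on T^0. *)
Fixpoint leibniz (R : realType) (T : finType) (l : T -> int)
    (f : T -> Vec R T) n : n.-tuple T -> Vec R (n.-tuple T) :=
  match n with
  | 0 => fun _ => 0
  | n'.+1 => fun t =>
      tens (f (thead t)) (delta R (behead_tuple t)) +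
      (-1) ^ l (thead t) *:
        tens (delta R (thead t)) (leibniz l f (behead_tuple t))
  end.

Inductive letter := La | Lb | Lc.

Definition letter_to_ord (x : letter) : 'I_3 :=
  match x with La => inord 0 | Lb => inord 1 | Lc => inord 2 end.
Definition letter_of_ord (i : 'I_3) : letter :=
  match val i with 0 => La | 1 => Lb | _ => Lc end.
Lemma letter_to_ordK : cancel letter_to_ord letter_of_ord.
Proof. by case; rewrite /letter_of_ord /= inordK. Qed.
HB.instance Definition _ := Finite.copy letter (can_type letter_to_ordK).

(* word p is the basis of Omega^(p+1).  Throughout, an index p stands for
   k = p + 1, so that k ranges over the integers >= 1. *)
Definition word p := p.-tuple letter.

Definition lword p (w : word p) : int := - (count_mem Lb w)%:Z.

Definition wpartial_letter (R : realType) (x : letter) : Vec R letter :=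
  if x is Lb then delta R Lc - delta R La else 0.

Definition wpartial (R : realType) p : word p -> Vec R (word p) :=
  @leibniz R letter (fun x => lword [tuple x]) (wpartial_letter R) p.

(* d_(j+1), for j = 0, ..., p : the new word has a at (0-based) position j. *)
Definition wface p (j : 'I_p.+1) (w : word p) : word p.+1 :=
  [tuple if unlift j i is Some i' then tnth w i' else La | i < p.+1].

(* The index p + q.+1 of the result stands for (p + 1) + (q + 1). *)
Definition wcirc p q (w : word p) (w' : word q) : word (p + q.+1) :=
  cat_tuple w (cons_tuple Lc w').

(* The basis of Omega_m^(p+1).  We take Omega_0 to be the unit for the box
   product (one basis vector in each degree) and Omega_(m+1) to be
   Omega [x] Omega_m. *)
Definition mword m p := m.-tuple (word p).

Definition Omega (R : realType) m p := Vec R (mword m p).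

Definition lmword m p (t : mword m p) : int := \sum_(i < m) lword (tnth t i).

Definition mpartial (R : realType) m p : mword m p -> Omega R m p :=
  @leibniz R (word p) (@lword p) (@wpartial R p) m.

Definition mface (R : realType) m p (j : 'I_p.+1) (t : mword m p) :
    Omega R m p.+1 :=
  delta R (map_tuple (wface j) t).

Fixpoint mcirc (R : realType) m p q :
    mword m p -> mword m q -> Omega R m (p + q.+1) :=
  match m with
  | 0 => fun _ _ => delta R [tuple]
  | m'.+1 => fun t t' =>
      (-1) ^ (lmword (behead_tuple t : mword m' p) * lword (thead t')) *:
      tens (delta R (wcirc (thead t) (thead t')))
           (mcirc R (behead_tuple t : mword m' p)
                    (behead_tuple t' : mword m' q))
  end.

(* Omega_m^(p+1)(l), as a subspace of Omega_m^(p+1). *)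
Definition in_Omega (R : realType) m p (l : int) (x : Omega R m p) : Prop :=
  forall t, x t != 0 -> lmword t = l.

(* The full product of the Omega_m^k; the homogeneous components of the DGA are
   the subspaces in_Obar n.  The operations star and dtot make sense on the
   whole product, because their signs only depend on the bidegrees of basis
   elements. *)
Definition Obar (R : realType) m := forall p, Omega R m p.

Section ObarLmod.
Variables (R : realType) (m : nat).

HB.instance Definition _ := Choice.copy (Obar R m) (forall p, Omega R m p).

Let oadd (x y : Obar R m) : Obar R m := fun p => x p + y p.
Let oopp (x : Obar R m) : Obar R m := fun p => - x p.
Let ozero : Obar R m := fun p => 0.
Let oscale (a : R) (x : Obar R m) : Obar R m := fun p => a *: x p.

Let oaddA : associative oadd.
Proof. by move=> x y z; apply: functional_extensionality_dep => p; apply: addrA. Qed.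
Let oaddC : commutative oadd.
Proof. by move=> x y; apply: functional_extensionality_dep => p; apply: addrC. Qed.
Let oadd0 : left_id ozero oadd.
Proof. by move=> x; apply: functional_extensionality_dep => p; apply: add0r. Qed.
Let oaddN : left_inverse ozero oopp oadd.
Proof. by move=> x; apply: functional_extensionality_dep => p; apply: addNr. Qed.

HB.instance Definition _ :=
  GRing.isZmodule.Build (Obar R m) oaddA oaddC oadd0 oaddN.

Let oscaleA a b (x : Obar R m) : oscale a (oscale b x) = oscale (a * b) x.
Proof. by apply: functional_extensionality_dep => p; apply: scalerA. Qed.
Let oscale1 : left_id 1 oscale.
Proof. by move=> x; apply: functional_extensionality_dep => p; apply: scale1r. Qed.
Let oscaleDr : right_distributive oscale +%R.
Proof. by move=> a x y; apply: functional_extensionality_dep => p; apply: scalerDr. Qed.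
Let oscaleDl (x : Obar R m) : {morph oscale^~ x : a b / a + b}.
Proof. by move=> a b; apply: functional_extensionality_dep => p; apply: scalerDl. Qed.

HB.instance Definition _ := GRing.Zmodule_isLmodule.Build R (Obar R m)
  oscaleA oscale1 oscaleDr oscaleDl.

End ObarLmod.

Definition in_Obar (R : realType) m (n : int) (x : Obar R m) : Prop :=
  forall p, in_Omega (n - p.+1%:Z) (x p).

Definition tdeg m p (t : mword m p) : int := p.+1%:Z + lmword t.

Definition star_comp (R : realType) m p q :
    Omega R m p -> Omega R m q -> Omega R m (p + q.+1) :=
  bilext (fun (t : mword m p) (t' : mword m q) =>
            (-1) ^ (p.+1%:Z * tdeg t') *: mcirc R t t').

Lemma star_index n (p : 'I_n) : (p + (n - p.+1).+1)%N = n.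
Proof. by rewrite addnS -addSn subnKC. Qed.

(* The component of index n collects the products of the components p of x and
   q of y with p + q + 1 = n. *)
Definition star (R : realType) m (x y : Obar R m) : Obar R m := fun n =>
  \sum_(p < n) ecast k (Omega R m k) (star_index p)
                 (star_comp (x p) (y (n - p.+1)%N)).

Definition dtot (R : realType) m (x : Obar R m) : Obar R m := fun p =>
  linext (@mpartial R m p) (x p) +
  match p with
  | 0 => 0
  | q.+1 => linext (fun t : mword m q =>
       (-1) ^ tdeg t *: \sum_(j < q.+1) (-1) ^+ j.+1 *: mface R j t) (x q)
  end.

Definition universal_MC (R : realType) m (w : Obar R m) : Prop :=
  [/\ in_Obar 1 w,
      w 0 = delta R [tuple [tuple] | i < m]
    & dtot w + star w w = 0].

(* The action of S_m: the factor at position i is moved to position s i, with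
   the Koszul sign given by the inversions of s.  By act_comp_adjacent and actM
   below, this is the action which is given on adjacent transpositions by the
   graded flip (in the group 'S_m, (s * s') i = s' (s i)). *)
Definition koszul m p (s : 'S_m) (t : mword m p) : int :=
  \sum_(i < m) \sum_(j < m | (i < j)%N && (s j < s i)%N)
    lword (tnth t i) * lword (tnth t j).

Definition mperm m p (s : 'S_m) (t : mword m p) : mword m p :=
  [tuple tnth t ((s^-1)%g i) | i < m].

Definition act_comp (R : realType) m p (s : 'S_m) : Omega R m p -> Omega R m p :=
  linext (fun t : mword m p => (-1) ^ koszul s t *: delta R (mperm s t)).

Definition act (R : realType) m (s : 'S_m) (x : Obar R m) : Obar R m :=
  fun p => act_comp s (x p).

Lemma linext_delta (R : realType) (S T : finType) (f : S -> Vec R T) (v : S) :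
  linext f (delta R v) = f v.
Proof.
rewrite /linext (bigD1 v) //= ffunE eqxx scale1r big1 ?addr0 // => w /negPf wv.
by rewrite ffunE wv scale0r.
Qed.

Lemma linext_comp (R : realType) (S T U : finType) (g : T -> Vec R U)
    (f : S -> Vec R T) (x : Vec R S) :
  linext g (linext f x) = linext (fun v => linext g (f v)) x.
Proof.
rewrite /linext; under [RHS]eq_bigr do rewrite scaler_sumr.
rewrite exchange_big /=; apply: eq_bigr => t _.
rewrite sum_ffunE scaler_suml; apply: eq_bigr => v _.
by rewrite ffunE scalerA.
Qed.

Lemma act_comp_adjacent (R : realType) m p (i j : 'I_m) (t : mword m p) :
  j = i.+1 :> nat ->
  act_comp (tperm i j) (delta R t) =
  (-1) ^ (lword (tnth t i) * lword (tnth t j)) *: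
    delta R [tuple tnth t (tperm i j h) | h < m].
Proof.
move=> ji; rewrite /act_comp linext_delta /mperm tpermV; congr (_ ^ _ *: _).
have ij : (i < j)%N by rewrite ji.
have val_tperm h : tperm i j h = (if h == i :> nat then j else
                                  if h == j :> nat then i else h) :> nat.
  by rewrite permE /= -!val_eqE /=; do 2?case: ifP.
have inv (a b : 'I_m) : (a < b)%N && (tperm i j b < tperm i j a)%N = (a == i) && (b == j).
  rewrite !val_tperm -!val_eqE /=; move: ji ij.
  by case: ifP; case: ifP; do ?[case: ifP]; lia.
rewrite /koszul (bigD1 i) //= [X in _ + X]big1 ?addr0; last first.
  by move=> a /negPf ai; rewrite big1 // => b; rewrite inv ai.
by rewrite (big_pred1 j) // => b; rewrite /= inv eqxx.
Qed.

Lemma sign_koszul (R : realType) m p (s : 'S_m) (t : mword m p) :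
  (-1) ^ koszul s t = \prod_(i < m) \prod_(j < m)
    (if (i < j)%N && (s j < s i)%N
     then (-1) ^ (lword (tnth t i) * lword (tnth t j)) else 1) :> R.
Proof.
have expD : {morph (fun n : int => (-1 : R) ^ n) : k l / k + l >-> k * l}.
  by move=> k l; rewrite expfzDr // oppr_eq0 oner_eq0.
rewrite /koszul (big_morph _ expD (expr0z _)); apply: eq_bigr => i _.
by rewrite (big_morph _ expD (expr0z _)) big_mkcond.
Qed.

Lemma prod_pairs (R : comNzRingType) m (G : 'I_m -> 'I_m -> R) :
  (forall i, G i i = 1) ->
  \prod_i \prod_j G i j =
  \prod_(i < m) \prod_(j < m) if (i < j)%N then G i j * G j i else 1.
Proof.
move=> G1.
transitivity ((\prod_(i < m) \prod_(j < m) if (i < j)%N then G i j else 1) *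
              (\prod_(i < m) \prod_(j < m) if (i < j)%N then G j i else 1)).
  rewrite [X in _ * X]exchange_big -big_split /=; apply: eq_bigr => i _.
  rewrite -big_split; apply: eq_bigr => j _ /=.
  by case: ltngtP => [||/val_inj->]; rewrite ?mulr1 ?mul1r.
rewrite -big_split; apply: eq_bigr => i _; rewrite -big_split.
by apply: eq_bigr => j _ /=; case: ifP; rewrite ?mulr1.
Qed.

Lemma koszulM (R : realType) m p (s s' : 'S_m) (t : mword m p) :
  (-1) ^ koszul (s * s')%g t =
  (-1) ^ koszul s t * (-1) ^ koszul s' (mperm s t) :> R.
Proof.
rewrite !sign_koszul.
rewrite [X in _ * X](reindex_inj (@perm_inj _ s)) /=.
under [X in _ * X]eq_bigr => i _ do rewrite (reindex_inj (@perm_inj _ s)) /=.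
rewrite [X in _ * X]prod_pairs; last by move=> i; rewrite ltnn.
rewrite -big_split; apply: eq_bigr => i _; rewrite -big_split.
apply: eq_bigr => j _ /=; rewrite !tnth_mktuple !permK !permM.
case: ltnP => //= ij; last by rewrite mulr1.
rewrite [lword (tnth t j) * _]mulrC.
set e := (-1) ^ _.
have ee : e * e = 1 :> R.
  by rewrite /e -expfzMl mulrNN mulr1 exp1rz.
have sij : s i != s j :> nat.
  by apply: contraTneq ij => /val_inj/perm_inj ->; rewrite ltnn.
have sij' : s' (s i) != s' (s j) :> nat.
  by apply: contra_neq sij => /val_inj/perm_inj ->.
by case: (ltngtP (s i) (s j)) sij => // _ _;
  case: (ltngtP (s' (s i)) (s' (s j))) sij' => // _ _ /=;
  rewrite ?mulr1 ?mul1r ?ee.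
Qed.

Lemma actM (R : realType) m (s s' : 'S_m) (x : Obar R m) :
  act (s * s')%g x = act s' (act s x).
Proof.
apply: functional_extensionality_dep => p.
rewrite /act /act_comp linext_comp; congr (linext _ _).
apply/funext => t.
rewrite /linext (bigD1 (mperm s t)) //= big1 ?addr0; last first.
  by move=> v /negPf vt; rewrite !ffunE vt scaler0 scale0r.
rewrite !ffunE eqxx scalerA koszulM; congr (_ *: delta R _).
  by congr (_ * _); rewrite [_ *: _]mulr1.
by apply: eq_from_tnth => i; rewrite !tnth_mktuple invMg permM.
Qed.

Definition symmetric_elt (R : realType) m (x : Obar R m) : Prop :=
  forall s : 'S_m, act s x = x.

(* The algebra R 1 + Obar obtained by adjoining a unit; (c, x) is c 1 + x. *)
Definition uObar (R : realType) m := (R^o * Obar R m)%type.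

Definition uone (R : realType) m : uObar R m := (1, 0).

Definition uin (R : realType) m (x : Obar R m) : uObar R m := (0, x).

Definition ustar (R : realType) m (u v : uObar R m) : uObar R m :=
  (u.1 * v.1, u.1 *: v.2 + v.1 *: u.2 + star u.2 v.2).

Definition udtot (R : realType) m (u : uObar R m) : uObar R m :=
  uin (dtot u.2).

Definition strong_gauge (R : realType) m (w th : Obar R m) (u : uObar R m) :
    Prop :=
  (exists2 a : Obar R m, in_Obar 0 a & u = uone R m + uin a) /\
  exists u' : uObar R m,
    [/\ ustar u u' = uone R m, ustar u' u = uone R m
      & ustar (ustar u (uin w)) u' - uin th = ustar (udtot u) u'].

Definition homotopic (R : realType) m (w th : Obar R m) (u u' : uObar R m) :
    Prop :=
  exists2 h : Obar R m, in_Obar (-1) h &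
    u - u' = uin (dtot h + star h w + star th h).

(* Main.v *)
Require Import Defs.
From mathcomp Require Import all_boot all_order all_algebra all_fingroup.
From mathcomp Require Import boolp reals zify ring.

(** Forget everything except the internal differential.  The letters a, b, c
    with partial b = c - a span the chains of an interval, and Omega_m^k is a
    tensor power of this complex, the chains of a cube of dimension m (k - 1).
    So its homology is one-dimensional and sits in degree l = 0.  The lemma
    mword_contraction makes this explicit: the identity minus a projection
    which vanishes outside degree 0 is null-homotopic.

    Obstruction theory by induction on k gives the rest.  In index k the
    Maurer-Cartan equation reads partial w_k = - N_k, where N_k only depends on
    w_1, ..., w_(k-1) and has degree l = 2 - k.  If the equation holds in lower
    index, then N_k is a cycle by the Bianchi identity, hence a boundary when
    k > 2.  For k = 2 it is the difference of two vertices of a cube, which is a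
    boundary too.  All structure maps commute with the symmetric group (act_star,
    coface_act, partial_act), so the average of a solution is a symmetric
    solution.

    Let D y = d_tot y + th * y - (-1)^|y| y * w for Maurer-Cartan elements w and
    th; then D D = 0.  The element 1 + a is a gauge equivalence if and only if
    D a = w - th, and a homotopy between two of them is a solution h of
    D h = u - u'.  Both right-hand sides are D-cycles of total degree at most 1,
    with vanishing component in index 1; their other components have negative
    degree l, where partial is exact, so both equations can be solved index by
    index (dtw_acyclic).

    This uses that Obar is a differential graded algebra (starA, dtot_dtot,
    dtot_star).  An m-tuple of words of length p can be read column by column,
    as a word of length p over the alphabet of m-tuples of letters.  Up to the
    Koszul sign of this rearrangement the product and the differential become
    those of a free algebra, smul and sdiff, for which the identities are
    proved by induction on the word.  The lemmas series_star and series_dtot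
    transport them back. *)

Set Implicit Arguments.
Unset Strict Implicit.
Unset Printing Implicit Defensive.

Import Order.TTheory GRing.Theory Num.Theory.

Local Open Scope ring_scope.

(** * Free vector spaces and their tensor powers *)

Section FreeSpaces.
Variable R : realType.
Implicit Types S T : finType.

Lemma vecD T (x y : Vec R T) t : (x + y) t = x t + y t.
Proof. by rewrite ffunE. Qed.

Lemma vecN T (x : Vec R T) t : (- x) t = - x t.
Proof. by rewrite ffunE. Qed.

Lemma vecZ T (a : R) (x : Vec R T) t : (a *: x) t = a * x t.
Proof. by rewrite ffunE. Qed.

Lemma vec0 T t : (0 : Vec R T) t = 0.
Proof. by rewrite ffunE. Qed.

Definition vecE := (vecD, vecN, vecZ, vec0).

Lemma vec_sum T (I : finType) (P : pred I) (F : I -> Vec R T) t :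
  (\sum_(i | P i) F i) t = \sum_(i | P i) F i t.
Proof. by rewrite sum_ffunE. Qed.

Lemma deltaE T (v t : T) : delta R v t = (t == v)%:R.
Proof. by rewrite ffunE. Qed.

Lemma linextE S T (f : S -> Vec R T) x t : linext f x t = \sum_v x v * f v t.
Proof. by rewrite /linext vec_sum; apply: eq_bigr => v _; rewrite vecZ. Qed.

Lemma linextD S T (f : S -> Vec R T) x y :
  linext f (x + y) = linext f x + linext f y.
Proof.
apply/ffunP => t; rewrite vecD !linextE -big_split.
by apply: eq_bigr => v _; rewrite vecD mulrDl.
Qed.

Lemma linextZ S T (f : S -> Vec R T) a x : linext f (a *: x) = a *: linext f x.
Proof.
apply/ffunP => t; rewrite vecZ !linextE mulr_sumr.
by apply: eq_bigr => v _; rewrite vecZ mulrA.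
Qed.

Lemma linext0 S T (f : S -> Vec R T) : linext f 0 = 0.
Proof. by apply: (addrI (linext f 0)); rewrite -linextD !addr0. Qed.

Lemma linextN S T (f : S -> Vec R T) x : linext f (- x) = - linext f x.
Proof. by rewrite -scaleN1r linextZ scaleN1r. Qed.

Lemma linextB S T (f : S -> Vec R T) x y :
  linext f (x - y) = linext f x - linext f y.
Proof. by rewrite linextD linextN. Qed.

Lemma linext_sum S T (f : S -> Vec R T) (I : finType) (F : I -> Vec R S) :
  linext f (\sum_i F i) = \sum_i linext f (F i).
Proof. by apply: (big_morph _ (linextD f) (linext0 f)). Qed.

Lemma linext_id T (x : Vec R T) : linext (@delta R T) x = x.
Proof.
apply/ffunP => t; rewrite linextE (bigD1 t) //= deltaE eqxx mulr1 big1 ?addr0 //.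
by move=> v /negPf vt; rewrite deltaE eq_sym vt mulr0.
Qed.

Lemma linext_eq S T (f g : S -> Vec R T) : f =1 g -> linext f =1 linext g.
Proof. by move=> fg x; apply: eq_bigr => v _; rewrite fg. Qed.

Lemma linext_fadd S T (f g : S -> Vec R T) x :
  linext f x + linext g x = linext (fun v => f v + g v) x.
Proof.
by rewrite /linext -big_split; apply: eq_bigr => v _; rewrite scalerDr.
Qed.

Lemma linext_fopp S T (f : S -> Vec R T) x :
  - linext f x = linext (fun v => - f v) x.
Proof. by rewrite /linext -sumrN; apply: eq_bigr => v _; rewrite scalerN. Qed.

Lemma linext_f0 S T (f : S -> Vec R T) x : (forall v, f v = 0) ->
  linext f x = 0.
Proof. by move=> f0; rewrite /linext big1 // => v _; rewrite f0 scaler0. Qed.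

Definition twist T (l : T -> int) (x : Vec R T) : Vec R T :=
  [ffun t => (-1) ^ l t * x t].

Section Tensor.
Variables (T : finType) (n : nat).
Implicit Types (x : Vec R T) (y : Vec R (n.-tuple T)).

Lemma tensE x y t : tens x y t = x (thead t) * y (behead_tuple t).
Proof. by rewrite ffunE. Qed.

Lemma tensDl x x' y : tens (x + x') y = tens x y + tens x' y.
Proof. by apply/ffunP => t; rewrite vecD !tensE vecD mulrDl. Qed.

Lemma tensDr x y y' : tens x (y + y') = tens x y + tens x y'.
Proof. by apply/ffunP => t; rewrite vecD !tensE vecD mulrDr. Qed.

Lemma tensZl a x y : tens (a *: x) y = a *: tens x y.
Proof. by apply/ffunP => t; rewrite vecZ !tensE vecZ mulrA. Qed.

Lemma tensZr a x y : tens x (a *: y) = a *: tens x y.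
Proof. by apply/ffunP => t; rewrite vecZ !tensE vecZ mulrCA. Qed.

Lemma tens0l y : tens 0 y = 0.
Proof. by apply/ffunP => t; rewrite !tensE vec0 mul0r vec0. Qed.

Lemma tens0r x : tens x (0 : Vec R (n.-tuple T)) = 0.
Proof. by apply/ffunP => t; rewrite !tensE vec0 mulr0 vec0. Qed.

Lemma tensNl x y : tens (- x) y = - tens x y.
Proof. by rewrite -scaleN1r tensZl scaleN1r. Qed.

Lemma tensNr x y : tens x (- y) = - tens x y.
Proof. by rewrite -scaleN1r tensZr scaleN1r. Qed.

Lemma tens_delta (v : T) (t : n.-tuple T) :
  tens (delta R v) (delta R t) = delta R [tuple of v :: t].
Proof.
apply/ffunP => u; rewrite tensE !deltaE [u in RHS]tuple_eta -natrM mulnb.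
by congr (_%:R); congr nat_of_bool; rewrite -!val_eqE /= eqseq_cons.
Qed.

(** Tensors of basis vectors span, so a bilinear formula for a linear map can be
    checked on them. *)
Lemma linext_tens (U : finType) (h : n.+1.-tuple T -> Vec R U)
    (k : Vec R T -> Vec R (n.-tuple T) -> Vec R U) x y :
  (forall (v : T) (t : n.-tuple T), h [tuple of v :: t] = k (delta R v) (delta R t)) ->
  (forall y x x', k (x + x') y = k x y + k x' y) ->
  (forall y a x, k (a *: x) y = a *: k x y) ->
  (forall x y y', k x (y + y') = k x y + k x y') ->
  (forall x a y, k x (a *: y) = a *: k x y) ->
  linext h (tens x y) = k x y.
Proof.
move=> hk kDl kZl kDr kZr.
have k0l y' : k 0 y' = 0 by rewrite -(scale0r 0) kZl scale0r.
have k0r x' : k x' 0 = 0 by rewrite -(scale0r 0) kZr scale0r.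
have tsuml I (r : seq I) F y' :
    tens (\sum_(i <- r) F i) y' = \sum_(i <- r) tens (F i) y'.
  exact: (big_morph (fun z => tens z y') (fun a b => tensDl a b y') (tens0l y')).
have tsumr I (r : seq I) (F : I -> Vec R (n.-tuple T)) x' :
    tens x' (\sum_(i <- r) F i) = \sum_(i <- r) tens x' (F i).
  exact: (big_morph (tens x') (tensDr x') (tens0r x')).
have ksuml I (r : seq I) F y' : k (\sum_(i <- r) F i) y' = \sum_(i <- r) k (F i) y'.
  exact: (big_morph (fun z => k z y') (kDl y') (k0l y')).
have ksumr I (r : seq I) F x' : k x' (\sum_(i <- r) F i) = \sum_(i <- r) k x' (F i).
  exact: (big_morph (k x') (kDr x') (k0r x')).
rewrite -[x]linext_id [linext _ x]/linext tsuml ksuml linext_sum.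
apply: eq_bigr => v _; rewrite tensZl kZl linextZ; congr (_ *: _).
rewrite -[y]linext_id [linext _ y]/linext tsumr ksumr linext_sum.
apply: eq_bigr => t _.
by rewrite tensZr kZr linextZ tens_delta linext_delta hk.
Qed.

End Tensor.

Lemma twistD T (l : T -> int) x y : twist l (x + y) = twist l x + twist l y.
Proof. by apply/ffunP => t; rewrite vecD !ffunE mulrDr. Qed.

Lemma twistZ T (l : T -> int) a x : twist l (a *: x) = a *: twist l x.
Proof. by apply/ffunP => t; rewrite vecZ !ffunE mulrCA. Qed.

Lemma twist_delta T (l : T -> int) v :
  twist l (delta R v) = (-1) ^ l v *: delta R v.
Proof.
apply/ffunP => t; rewrite vecZ !ffunE.
by have [->|_] := eqVneq t v; rewrite ?mulr0.
Qed.

Lemma signz_sq (k : int) : (-1) ^ k * (-1) ^ k = 1 :> R.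
Proof. by rewrite -expfzMl mulrNN mulr1 exp1rz. Qed.

Lemma signzD (j k : int) : (-1) ^ (j + k) = (-1) ^ j * (-1) ^ k :> R.
Proof. by rewrite expfzDr // oppr_eq0 oner_eq0. Qed.

Lemma signzS (k : int) : (-1) ^ (k + 1) = - (-1) ^ k :> R.
Proof. by rewrite signzD expr1z mulrN1. Qed.

Lemma signzP (k : int) : (-1) ^ (k - 1) = - (-1) ^ k :> R.
Proof. by rewrite signzD (_ : (-1) ^ (-1) = -1 :> R) ?mulrN1 // exprN1 invrN invr1. Qed.

(** * Contractions and their tensor powers *)

Definition of_degree S T (l : S -> int) (l' : T -> int) (d : int)
    (f : S -> Vec R T) := forall v t, f v t != 0 -> l' t = l v + d.

(** A contraction of a complex onto its part of degree 0: a homotopy s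
    between the identity and a chain map p which vanishes outside degree 0. *)
Record contraction T (l : T -> int) (f s p : T -> Vec R T) : Prop :=
  Contraction {
    ctr_deg_d : of_degree l l 1 f;
    ctr_deg_s : of_degree l l (-1) s;
    ctr_deg_p : forall v t, p v t != 0 -> l v = 0 /\ l t = 0;
    ctr_dd : forall v, linext f (f v) = 0;
    ctr_dp : forall v, linext f (p v) = 0;
    ctr_pd : forall v, linext p (f v) = 0;
    ctr_homotopy : forall v,
      linext f (s v) + linext s (f v) = delta R v - p v }.

Section Leibniz.
Variables (T : finType) (l : T -> int).
Variables f s p : T -> Vec R T.

(** Contract the first factor, and contract the others after the first one has
    been projected: the sum telescopes to the identity minus the tensor power
    of p.  There is no sign, because p lives in degree 0. *)
Fixpoint tens_homotopy n : n.-tuple T -> Vec R (n.-tuple T) :=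
  match n with
  | 0 => fun _ => 0
  | n'.+1 => fun t =>
      tens (s (thead t)) (delta R (behead_tuple t)) +
      tens (p (thead t)) (tens_homotopy (behead_tuple t))
  end.

Fixpoint tens_proj n : n.-tuple T -> Vec R (n.-tuple T) :=
  match n with
  | 0 => fun t => delta R t
  | n'.+1 => fun t => tens (p (thead t)) (tens_proj (behead_tuple t))
  end.

Definition sumdeg n (t : n.-tuple T) : int := \sum_(i < n) l (tnth t i).

Lemma sumdegS n (t : n.+1.-tuple T) :
  sumdeg t = l (thead t) + sumdeg (behead_tuple t).
Proof.
rewrite /sumdeg big_ord_recl; congr (_ + _).
by apply: eq_bigr => i _; rewrite [in LHS](tuple_eta t) tnthS.
Qed.

Lemma behead_cons n (v : T) (t : n.-tuple T) : behead_tuple [tuple of v :: t] = t.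
Proof. exact: val_inj. Qed.

Lemma linext_leibniz n x (y : Vec R (n.-tuple T)) :
  linext (@leibniz R T l f n.+1) (tens x y) =
  tens (linext f x) y + tens (twist l x) (linext (@leibniz R T l f n) y).
Proof.
apply: (linext_tens (k := fun x y => tens (linext f x) y +
   tens (twist l x) (linext (@leibniz R T l f n) y))).
- move=> v t /=; rewrite !linext_delta theadE behead_cons twist_delta.
  by rewrite tensZl.
- by move=> ? ? ?; rewrite linextD twistD !tensDl addrACA.
- by move=> ? ? ?; rewrite linextZ twistZ !tensZl scalerDr.
- by move=> ? ? ?; rewrite linextD !tensDr addrACA.
- by move=> ? ? ?; rewrite linextZ !tensZr scalerDr.
Qed.

Lemma linext_tens_homotopy n x (y : Vec R (n.-tuple T)) :
  linext (@tens_homotopy n.+1) (tens x y) =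
  tens (linext s x) y + tens (linext p x) (linext (@tens_homotopy n) y).
Proof.
apply: (linext_tens (k := fun x y => tens (linext s x) y +
   tens (linext p x) (linext (@tens_homotopy n) y))).
- by move=> v t /=; rewrite !linext_delta theadE behead_cons.
- by move=> ? ? ?; rewrite !linextD !tensDl addrACA.
- by move=> ? ? ?; rewrite !linextZ !tensZl scalerDr.
- by move=> ? ? ?; rewrite linextD !tensDr addrACA.
- by move=> ? ? ?; rewrite linextZ !tensZr scalerDr.
Qed.

Lemma linext_tens_proj n x (y : Vec R (n.-tuple T)) :
  linext (@tens_proj n.+1) (tens x y) =
  tens (linext p x) (linext (@tens_proj n) y).
Proof.
apply: (linext_tens (k := fun x y => tens (linext p x) (linext (@tens_proj n) y))).
- by move=> v t /=; rewrite !linext_delta theadE behead_cons.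
- by move=> ? ? ?; rewrite !linextD !tensDl.
- by move=> ? ? ?; rewrite !linextZ !tensZl.
- by move=> ? ? ?; rewrite linextD !tensDr.
- by move=> ? ? ?; rewrite linextZ !tensZr.
Qed.

Lemma addr_neq0 (V : zmodType) (x y : V) : x + y != 0 -> x != 0 \/ y != 0.
Proof.
by case: (eqVneq x 0) => [->|]; [rewrite add0r; right | left].
Qed.

Lemma delta_neq0 S (v t : S) : delta R v t != 0 -> t = v.
Proof. by rewrite deltaE pnatr_eq0 eqb0 negbK => /eqP. Qed.

Lemma leibniz_deg n : of_degree l l 1 f ->
  of_degree (@sumdeg n) (@sumdeg n) 1 (@leibniz R T l f n).
Proof.
move=> fd; elim: n => [|n IH] v t /=; first by rewrite vec0 eqxx.
rewrite vecD vecZ !tensE !sumdegS => /addr_neq0[].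
  by rewrite mulf_eq0 negb_or => /andP[/fd -> /delta_neq0 ->]; rewrite addrAC.
rewrite !mulf_eq0 !negb_or => /and3P[_ /delta_neq0 -> /IH ->].
by rewrite addrA.
Qed.

Hypothesis C : contraction l f s p.

Lemma twist_d v : twist l (f v) = - (-1) ^ l v *: f v.
Proof.
apply/ffunP => t; rewrite vecZ ffunE.
have [->|/(ctr_deg_d C) ->] := eqVneq (f v t) 0; first by rewrite !mulr0.
by rewrite signzS.
Qed.

Lemma twist_s v : twist l (s v) = - (-1) ^ l v *: s v.
Proof.
apply/ffunP => t; rewrite vecZ ffunE.
have [->|/(ctr_deg_s C) ->] := eqVneq (s v t) 0; first by rewrite !mulr0.
by rewrite signzP.
Qed.

Lemma twist_p v : twist l (p v) = p v.
Proof.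
apply/ffunP => t; rewrite ffunE.
have [->|/(ctr_deg_p C)[_ ->]] := eqVneq (p v t) 0; first by rewrite !mulr0.
by rewrite expr0z mul1r.
Qed.

Lemma sign_p v : (-1) ^ l v *: p v = p v.
Proof.
apply/ffunP => t; rewrite vecZ.
have [->|/(ctr_deg_p C)[-> _]] := eqVneq (p v t) 0; first by rewrite !mulr0.
by rewrite expr0z mul1r.
Qed.

Lemma tens_homotopy_deg n :
  of_degree (@sumdeg n) (@sumdeg n) (-1) (@tens_homotopy n).
Proof.
elim: n => [|n IH] v t /=; first by rewrite vec0 eqxx.
rewrite vecD !tensE !sumdegS => /addr_neq0[].
  rewrite mulf_eq0 negb_or => /andP[/(ctr_deg_s C) -> /delta_neq0 ->].
  by rewrite addrAC.
by rewrite !mulf_eq0 !negb_or => /andP[/(ctr_deg_p C)[-> ->] /IH ->]; rewrite !add0r.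
Qed.

Lemma tens_proj_deg n (v t : n.-tuple T) :
  tens_proj v t != 0 -> sumdeg v = 0 /\ sumdeg t = 0.
Proof.
elim: n => [|n IH] in v t *; first by rewrite /sumdeg !big_ord0.
rewrite /= !tensE !sumdegS mulf_eq0 negb_or.
by case/andP => [/(ctr_deg_p C)[-> ->] /IH[-> ->]]; rewrite !add0r.
Qed.

Lemma leibniz_dd n (v : n.-tuple T) :
  linext (@leibniz R T l f n) (leibniz l f v) = 0.
Proof.
elim: n => [|n IH] in v *; first by rewrite /= linext0.
rewrite /= linextD linextZ !linext_leibniz !linext_delta IH (ctr_dd C).
rewrite tens0l tens0r add0r addr0 twist_d.
by rewrite tensZl scaleNr addNr.
Qed.

Lemma leibniz_dp n (v : n.-tuple T) :
  linext (@leibniz R T l f n) (tens_proj v) = 0.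
Proof.
elim: n => [|n IH] in v *; first by apply: linext_f0.
by rewrite /= linext_leibniz IH (ctr_dp C) tens0l tens0r addr0.
Qed.

Lemma leibniz_pd n (v : n.-tuple T) :
  linext (@tens_proj n) (leibniz l f v) = 0.
Proof.
elim: n => [|n IH] in v *; first by rewrite /= linext0.
rewrite /= linextD linextZ !linext_tens_proj IH (ctr_pd C).
by rewrite tens0l tens0r scaler0 addr0.
Qed.

(** The mixed terms f (x) H and s (x) D occur with opposite signs, where H is
    the homotopy and D the differential on the remaining factors; what is left
    is (1 - p) (x) 1 + p (x) (1 - p^n). *)
Lemma leibniz_homotopy n (v : n.-tuple T) :
  linext (@leibniz R T l f n) (tens_homotopy v) +
  linext (@tens_homotopy n) (leibniz l f v) = delta R v - tens_proj v.
Proof.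
elim: n => [|n IH] in v *; first by rewrite /= !linext0 subrr addr0.
rewrite /= !linextD linextZ !linext_leibniz !linext_tens_homotopy !linext_delta.
rewrite (ctr_dp C) (ctr_pd C) !tens0l add0r addr0 twist_p twist_s.
rewrite [v in RHS]tuple_eta -tens_delta scalerDr.
rewrite -(tensZl _ (p _)) sign_p theadE behead_cons.
set x := thead v; set y := behead_tuple v.
have := IH y; set a := linext _ (tens_homotopy y).
move/(canRL (addKr _)) => ->.
have /(canRL (addrK _)) -> := ctr_homotopy C x.
rewrite !(tensDl, tensDr, tensNl, tensNr, tensZl, scaleNr).
by apply/ffunP => t; rewrite !vecE; ring.
Qed.

Lemma leibniz_contraction n : contraction (@sumdeg n) (@leibniz R T l f n)
  (@tens_homotopy n) (@tens_proj n).
Proof.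
split.
- exact: leibniz_deg (ctr_deg_d C).
- exact: tens_homotopy_deg.
- exact: tens_proj_deg.
- exact: leibniz_dd.
- exact: leibniz_dp.
- exact: leibniz_pd.
- exact: leibniz_homotopy.
Qed.

End Leibniz.

Lemma tnth_beheadE (T : Type) n (t : n.+1.-tuple T) i :
  tnth (behead_tuple t) i = tnth t (lift ord0 i).
Proof. by rewrite [in RHS](tuple_eta t) tnthS. Qed.

Definition tupd (T : Type) n (t : n.-tuple T) (i : 'I_n) (y : T) : n.-tuple T :=
  [tuple if j == i then y else tnth t j | j < n].

Lemma eq_tupdP (T : eqType) n (v t : n.-tuple T) i :
  reflect (forall j, j != i -> tnth v j = tnth t j) (v == tupd t i (tnth v i)).
Proof.
apply: (iffP eqP) => [-> j /negPf ji|vt]; first by rewrite tnth_mktuple ji.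
apply: eq_from_tnth => j; rewrite tnth_mktuple.
by have [->//|/vt] := eqVneq j i.
Qed.

Lemma leibniz_coef T (l : T -> int) (f : T -> Vec R T) n (v t : n.-tuple T) :
  leibniz l f v t =
  \sum_(i < n) (-1) ^ (\sum_(j < n | (j < i)%N) l (tnth t j)) *
     (f (tnth v i) (tnth t i) * (v == tupd t i (tnth v i))%:R).
Proof.
elim: n => [|n IH] in v t *; first by rewrite /= vec0 big_ord0.
rewrite /= vecD vecZ !tensE !deltaE big_ord_recl IH; congr (_ + _).
  rewrite big_pred0 // expr0z mul1r; congr (_ * _%:R).
  congr nat_of_bool; apply/eqP/eq_tupdP => [e j|e].
    by case: (unliftP ord0 j) => [k|] -> // _; rewrite -!tnth_beheadE e.
  by apply: eq_from_tnth => j; rewrite !tnth_beheadE e.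
rewrite !mulr_sumr; apply: eq_bigr => i _.
rewrite (bigD1 ord0) //= signzD.
rewrite (_ : \sum_(j < n.+1 | _) _ =
    \sum_(j < n | (j < i)%N) l (tnth (behead_tuple t) j)); last first.
  rewrite big_mkcond big_ord_recl /= add0r [RHS]big_mkcond /=.
  by apply: eq_bigr => j _; rewrite andbT tnth_beheadE.
rewrite -/(thead t) !tnth_beheadE.
have -> : (v == tupd t (lift ord0 i) (tnth v (lift ord0 i))) =
   (thead t == thead v) &&
   (behead_tuple v == tupd (behead_tuple t) i (tnth v (lift ord0 i))).
  apply/eq_tupdP/andP => [e|[/eqP e0]].
    split; first by rewrite /thead e.
    by rewrite -tnth_beheadE; apply/eq_tupdP => j ji; rewrite !tnth_beheadE e.
  rewrite -{1}tnth_beheadE => /eq_tupdP e j.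
  by case: (unliftP ord0 j) => [k|] -> // ki; rewrite -!tnth_beheadE e.
have [<-|_] /= := eqVneq (thead t) (thead v); rewrite ?mul1r ?mul0r ?mulr0 //.
by rewrite mulrA.
Qed.

(** The factors to the left of position i are the same in t and in the basis
    elements which are mapped to it, so the signs can be read off from t. *)
Lemma leibnizE T (l : T -> int) (f : T -> Vec R T) n x (t : n.-tuple T) :
  linext (@leibniz R T l f n) x t =
  \sum_(i < n) (-1) ^ (\sum_(j < n | (j < i)%N) l (tnth t j)) *
     \sum_y f y (tnth t i) * x (tupd t i y).
Proof.
rewrite linextE; under eq_bigr => v _ do rewrite leibniz_coef mulr_sumr.
rewrite exchange_big; apply: eq_bigr => i _ /=.
rewrite [in RHS](reindex_onto (fun v : n.-tuple T => tnth v i)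
  (fun y => tupd t i y)) /=;
  last by move=> y _; rewrite tnth_mktuple eqxx.
rewrite mulr_sumr [RHS]big_mkcond /=; apply: eq_bigr => v _.
rewrite [_ == v]eq_sym; case: eqP => [<-|_]; last by rewrite !mulr0.
by rewrite mulr1 mulrCA [x v * _]mulrC.
Qed.

(** The letters are the cells of an interval with vertices a, c and edge b;
    this homotopy slides c along b to a. *)
Definition letter_homotopy (x : letter) : Vec R letter :=
  if x is Lc then delta R Lb else 0.

Definition letter_proj (x : letter) : Vec R letter :=
  if x is Lb then 0 else delta R La.

Lemma letter_eqE (x y : letter) : (x == y) =
  match x, y with La, La | Lb, Lb | Lc, Lc => true | _, _ => false end.
Proof. by apply/eqP/idP; case: x; case: y. Qed.

Lemma letter_contraction :
  contraction (fun x => lword [tuple x]) (wpartial_letter R)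
    letter_homotopy letter_proj.
Proof.
split=> [[] []|[] []|[] []|[]|[]|[]|[]] //=;
  rewrite ?(vecE, deltaE, linext0, linextB, linext_delta) //= ?subrr ?addr0
    ?add0r ?subr0 // ?letter_eqE //= ?subrr ?eqxx //;
  by rewrite /lword /= ?letter_eqE ?eqxx.
Qed.

Lemma sumdeg_lword p : @sumdeg letter (fun x => lword [tuple x]) p =1 @lword p.
Proof.
elim: p => [|p IH] w; first by rewrite /sumdeg big_ord0 /lword tuple0.
by case/tupleP: w => x w; rewrite sumdegS IH theadE behead_cons /lword /=; lia.
Qed.

Definition word_homotopy p : word p -> Vec R (word p) :=
  @tens_homotopy _ letter_homotopy letter_proj p.

Definition word_proj p : word p -> Vec R (word p) :=
  @tens_proj _ letter_proj p.

Lemma word_contraction p :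
  contraction (@lword p) (@wpartial R p) (@word_homotopy p) (@word_proj p).
Proof.
have := leibniz_contraction letter_contraction p.
by rewrite (funext (@sumdeg_lword p)).
Qed.

Definition mword_homotopy m p : mword m p -> Omega R m p :=
  @tens_homotopy _ (@word_homotopy p) (@word_proj p) m.

Definition mword_proj m p : mword m p -> Omega R m p :=
  @tens_proj _ (@word_proj p) m.

(** Omega_m^(p+1) is the complex of chains of a cube of dimension m p: its
    differential is a Leibniz extension twice, from letters to words and from
    words to m-tuples of words. *)
Lemma mword_contraction m p :
  contraction (@lmword m p) (@mpartial R m p) (@mword_homotopy m p)
    (@mword_proj m p).
Proof. exact: leibniz_contraction (word_contraction p) m. Qed.

End FreeSpaces.

(** * Series in words over an alphabet *)

(** A function on words over an alphabet T of graded letters is read as a series.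
    It stands for a combination of words | v_1 | v_2 | ... | v_n | in which the
    symbols | have degree 1: the product joins two of them by a letter c, and
    the differential is the derivation which sends | to | a | and v to f v, up
    to one overall sign.  Recursion on the first letter makes the identities
    below immediate by induction. *)
Section Series.
Variables (R : realType) (T : finType) (l : T -> int) (f : T -> T -> R).
Variables a c : T.
Implicit Types (x y z : seq T -> R) (s : seq T) (v : T).

Fixpoint sdiff x s : R :=
  match s with
  | [::] => 0
  | v :: s' => - ((v == a)%:R * x s' + \sum_w f w v * x (w :: s') +
                  (-1) ^ l v * sdiff (fun r => x (v :: r)) s')
  end.

Fixpoint smul x y s : R :=
  match s with
  | [::] => 0
  | v :: s' => (v == c)%:R * (x [::] * y s') + smul (fun r => x (v :: r)) y s'
  end.

(** The sign of the degree of s with a symbol of degree 1 before each letter. *)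
Definition ssign s : R := foldr (fun v e => - (-1) ^ l v * e) 1 s.

Definition sgrade x s : R := - ssign s * x s.

Lemma sdiffE x s : sdiff x s = - \sum_(j < size s) ssign (take j s) *
  ((nth a s j == a)%:R * x (take j s ++ drop j.+1 s) +
   \sum_w f w (nth a s j) * x (take j s ++ w :: drop j.+1 s)).
Proof.
elim: s x => [|v s IH] x /=; first by rewrite big_ord0 oppr0.
rewrite big_ord_recl /= drop0 mul1r; congr (- (_ + _)).
rewrite IH mulrN -mulNr mulr_sumr; apply: eq_bigr => j _ /=.
by rewrite mulrA.
Qed.

Lemma smulE x y s : smul x y s =
  \sum_(j < size s) (nth a s j == c)%:R * (x (take j s) * y (drop j.+1 s)).
Proof.
elim: s x => [|v s IH] x /=; first by rewrite big_ord0.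
by rewrite big_ord_recl /= drop0 IH.
Qed.

Lemma sdiffD x y s : sdiff (fun r => x r + y r) s = sdiff x s + sdiff y s.
Proof.
elim: s x y => [|v s IH] x y; first by rewrite /= addr0.
rewrite /= IH; under eq_bigr do rewrite mulrDr; rewrite big_split /=; ring.
Qed.

Lemma sdiffZ k x s : sdiff (fun r => k * x r) s = k * sdiff x s.
Proof.
elim: s x => [|v s IH] x; first by rewrite /= mulr0.
rewrite /= IH; under eq_bigr do rewrite mulrCA; rewrite -mulr_sumr; ring.
Qed.

Lemma sdiff0 s : sdiff (fun=> 0) s = 0.
Proof. by have := sdiffZ 0 (fun=> 0) s; rewrite mulr0 mul0r. Qed.

Lemma sdiffN x s : sdiff (fun r => - x r) s = - sdiff x s.
Proof.
rewrite -mulN1r -sdiffZ; congr (sdiff _ s); apply/funext => r.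
by rewrite mulN1r.
Qed.

Lemma sdiff_sum (I : finType) (F : I -> seq T -> R) s :
  sdiff (fun r => \sum_i F i r) s = \sum_i sdiff (F i) s.
Proof.
elim: (index_enum I) => [|i r IH].
  by under eq_fun do rewrite big_nil; rewrite sdiff0 big_nil.
by under eq_fun do rewrite big_cons; rewrite sdiffD IH big_cons.
Qed.

Lemma smulDl x x' y s : smul (fun r => x r + x' r) y s = smul x y s + smul x' y s.
Proof. by elim: s x x' => [|v s IH] x x' /=; rewrite ?IH; ring. Qed.

Lemma smulZl k x y s : smul (fun r => k * x r) y s = k * smul x y s.
Proof. by elim: s x => [|v s IH] x /=; rewrite ?IH; ring. Qed.

Lemma smulNl x y s : smul (fun r => - x r) y s = - smul x y s.
Proof. by elim: s x => [|v s IH] x /=; rewrite ?IH; ring. Qed.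

Lemma smul0l y s : smul (fun=> 0) y s = 0.
Proof. by elim: s => [|v s IH] /=; rewrite ?IH; ring. Qed.

Lemma smul_suml (I : finType) (F : I -> seq T -> R) y s :
  smul (fun r => \sum_i F i r) y s = \sum_i smul (F i) y s.
Proof.
elim: (index_enum I) => [|i r IH].
  by under eq_fun do rewrite big_nil; rewrite smul0l big_nil.
by under eq_fun do rewrite big_cons; rewrite smulDl IH big_cons.
Qed.

Lemma smulA x y z s : smul (smul x y) z s = smul x (smul y z) s.
Proof.
elim: s x => [|v s IH] x //=; rewrite smulDl IH mul0r mulr0 add0r !smulZl; ring.
Qed.

Hypothesis f_deg : forall w v, f w v != 0 -> l v = l w + 1.
Hypothesis ff_coef : forall u v, \sum_w f w v * f u w = 0.
Hypotheses (fa : forall v, f a v = 0) (fc : forall v, f c v = 0).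
Hypotheses (la : l a = 0) (lc : l c = 0).

Lemma sign_f w v : (-1) ^ l w * f w v = - (-1) ^ l v * f w v.
Proof.
have [->|/f_deg ->] := eqVneq (f w v) 0; first by rewrite !mulr0.
by rewrite signzS opprK.
Qed.

(** After one letter is split off, the mixed terms cancel because f changes the
    parity of the letter and f a = 0. *)
Lemma sdiff_sdiff x s : sdiff (sdiff x) s = 0.
Proof.
elim: s x => [|v s IH] x //=.
rewrite (_ : (fun r => - _) = (fun r => - ((v == a)%:R * x r +
    \sum_w f w v * x (w :: r) + (-1) ^ l v * sdiff (fun r => x (v :: r)) r))) //.
rewrite sdiffN !sdiffD. rewrite !sdiffZ IH sdiff_sum mulr0 addr0.
under [\sum_i sdiff _ _]eq_bigr do rewrite sdiffZ.
(* The three terms come from the letter a, from f twice, and from f followed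
   by the differential of the rest. *)
rewrite (eq_bigr (fun w => - (f w v * ((w == a)%:R * x s)) -
  \sum_u f w v * f u w * x (u :: s) +
  (-1) ^ l v * (f w v * sdiff (fun r => x (w :: r)) s))); last first.
  move=> w _; rewrite mulrN !mulrDr !opprD mulr_sumr; congr (_ - _ + _).
    by apply: eq_bigr => u _; rewrite mulrA.
  by rewrite [f w v * (_ * _)]mulrA [f w v * _]mulrC sign_f; ring.
rewrite !big_split /= -mulr_sumr.
rewrite [X in _ + (X + _ + _)]big1; last first.
  move=> w _; have [->|_] := eqVneq w a; last by rewrite mul0r mulr0 oppr0.
  by rewrite fa mul0r oppr0.
rewrite [X in _ + (_ + X + _)](_ : _ = 0); last first.
  rewrite sumrN exchange_big big1 ?oppr0 // => u _.
  by rewrite -mulr_suml ff_coef mul0r.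
have [->|_] := eqVneq v a; rewrite ?mul0r; last by ring.
by rewrite la expr0z; ring.
Qed.

Lemma sgrade_cons x v : (fun r => sgrade x (v :: r)) =
  (fun r => - (-1) ^ l v * sgrade (fun r => x (v :: r)) r).
Proof. by apply/funext => r; rewrite /sgrade /= mulrA !mulrN mulNr. Qed.

Lemma sdiff_smul x y s :
  sdiff (smul x y) s = smul (sdiff x) y s + smul (sgrade x) (sdiff y) s.
Proof.
elim: s x => [|v s IH] x; first by rewrite /= addr0.
rewrite [LHS]/= [smul (sdiff x) _ _]/= [smul (sgrade x) _ _]/=.
rewrite sgrade_cons smulZl smulNl !smulDl !smulZl sdiffD.
rewrite (sdiffZ (v == c)%:R (fun r => x [::] * y r)) (sdiffZ (x [::]) y).
rewrite IH smul_suml.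
rewrite [sgrade x [::]]/sgrade /=.
rewrite (eq_bigr (fun w => f w v * smul (fun r => x (w :: r)) y s)); last first.
  move=> w _; rewrite mulrDr.
  have [->|_] := eqVneq w c; last by rewrite mul0r mulr0 add0r.
  by rewrite fc !mul0r add0r.
rewrite [\sum_i smul _ _ _](eq_bigr (fun w => f w v * smul (fun r => x (w :: r)) y s));
  last by move=> w _; rewrite smulZl.
have [->|_] := eqVneq v c; rewrite ?mul0r; last by ring.
by rewrite lc expr0z; ring.
Qed.

End Series.

(** * The structure maps in coordinates *)

Definition mkw n (h : nat -> letter) : word n  := [tuple of mkseq h n].

Definition mk m n (g : nat -> nat -> letter) : mword m n :=
  [tuple mkw n (g i) | i < m].

Lemma tnth_mkw n h (j : 'I_n) : tnth (mkw n h) j = h j.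
Proof. by rewrite (tnth_nth La) /= nth_mkseq. Qed.

Lemma tnth_mk m n g (i : 'I_m) : tnth (mk m n g) i = mkw n (g i).
Proof. by rewrite tnth_mktuple. Qed.

Lemma eq_mkw n h h' : (forall j, (j < n)%N -> h j = h' j) -> mkw n h = mkw n h'.
Proof. by move=> e; apply: eq_from_tnth => j; rewrite !tnth_mkw e. Qed.

Lemma eq_mk m n g g' : (forall i j, (i < m)%N -> (j < n)%N -> g i j = g' i j) ->
  mk m n g = mk m n g'.
Proof.
by move=> e; apply: eq_from_tnth => i; rewrite !tnth_mk; apply: eq_mkw => j; apply: e.
Qed.

(** The part of a grid behind column p. *)
Definition gcirc p (g : nat -> nat -> letter) i j := g i (p.+1 + j)%N.

Lemma wcirc_eq p q (u : word p) (u' : word q) h :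
  (wcirc u u' == mkw _ h) =
  [&& u == mkw p h, u' == mkw q (fun j => h (p.+1 + j)%N) & h p == Lc].
Proof.
rewrite -!val_eqE /= /mkseq iotaD map_cat eqseq_cat ?size_map ?size_iota ?size_tuple //.
congr (_ && _); rewrite /= eqseq_cons andbC add0n [Lc == _]eq_sym.
by rewrite -[p.+1]addn0 iotaDl -map_comp addn0.
Qed.

Lemma wface_eq q (j : 'I_q.+1) (w : word q) h :
  (wface j w == mkw q.+1 h) =
  (w == mkw q (fun k => h (bump j k))) && (h j == La).
Proof.
apply/eqP/andP => [e|[/eqP-> /eqP hj]].
  split; apply/eqP.
    apply: eq_from_tnth => k; have := congr1 (fun w => tnth w (lift j k)) e.
    by rewrite /= tnth_mktuple liftK !tnth_mkw.
  have := congr1 (fun w => tnth w j) e.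
  by rewrite /= tnth_mktuple unlift_none tnth_mkw.
apply: eq_from_tnth => i; rewrite tnth_mktuple tnth_mkw.
by case: unliftP => [k ->|->] //; rewrite tnth_mkw.
Qed.

Lemma mcirc_eq m p q (t : mword m p) (t' : mword m q) g :
  ([tuple wcirc (tnth t i) (tnth t' i) | i < m] == mk m _ g) =
  [&& t == mk m p g, t' == mk m q (gcirc p g) & [forall i : 'I_m, g i p == Lc]].
Proof.
apply/eqP/and3P => [e|[/eqP-> /eqP-> /forallP gc]]; last first.
  apply: eq_from_tnth => i; rewrite tnth_mktuple !tnth_mk; apply/eqP.
  by rewrite wcirc_eq !eqxx gc.
have {}e i : [&& tnth t i == mkw p (g i),
   tnth t' i == mkw q (fun j => g i (p.+1 + j)%N) & g i p == Lc].
  rewrite -wcirc_eq; apply/eqP; have := congr1 (fun w => tnth w i) e.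
  by rewrite /= tnth_mktuple tnth_mk.
split; last by apply/forallP => i; case/and3P: (e i).
  by apply/eqP/eq_from_tnth => i; rewrite tnth_mk; case/and3P: (e i) => /eqP.
by apply/eqP/eq_from_tnth => i; rewrite tnth_mk; case/and3P: (e i) => _ /eqP.
Qed.

Lemma mface_eq m q (j : 'I_q.+1) (t : mword m q) g :
  (map_tuple (wface j) t == mk m q.+1 g) =
  (t == mk m q (fun i k => g i (bump j k))) && [forall i : 'I_m, g i j == La].
Proof.
apply/eqP/andP => [e|[/eqP-> /forallP ga]]; last first.
  apply: eq_from_tnth => i; rewrite tnth_map !tnth_mk; apply/eqP.
  by rewrite wface_eq eqxx ga.
have {}e i : (tnth t i == mkw q (fun k => g i (bump j k))) && (g i j == La).
  rewrite -wface_eq; apply/eqP; have := congr1 (fun w => tnth w i) e.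
  by rewrite /= tnth_map tnth_mk.
split; last by apply/forallP => i; case/andP: (e i).
by apply/eqP/eq_from_tnth => i; rewrite tnth_mk; case/andP: (e i) => /eqP.
Qed.

(** The exponent of the sign of the product: a letter of t in row i has to pass
   the rows of t' above it. *)
Definition cross m p q (t : mword m p) (t' : mword m q) : int :=
  \sum_(i < m) \sum_(k < m | (k < i)%N) lword (tnth t i) * lword (tnth t' k).

Section Coordinates.
Variable R : realType.

Lemma mcircE m p q (t : mword m p) (t' : mword m q) :
  mcirc R t t' = (-1) ^ cross t t' *:
    delta R [tuple wcirc (tnth t i) (tnth t' i) | i < m].
Proof.
elim: m t t' => [|m IH] t t' /=.
  rewrite /cross big_ord0 expr0z scale1r; congr delta.
  by rewrite [RHS]tuple0.
rewrite IH tensZr scalerA -signzD tens_delta; congr ((-1) ^ _ *: delta R _).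
  rewrite /cross [in RHS]big_ord_recl [X in _ = X + _]big_pred0 // add0r.
  rewrite /lmword mulr_suml -big_split; apply: eq_bigr => i _ /=.
  rewrite [in RHS]big_mkcond [in RHS]big_ord_recl /= tnth_beheadE; congr (_ + _).
  rewrite [in LHS]big_mkcond; apply: eq_bigr => k _.
  by rewrite !tnth_beheadE.
apply: eq_from_tnth => i; rewrite tnth_mktuple.
case: (unliftP ord0 i) => [k|] ->; last by rewrite tnth0.
by rewrite tnthS tnth_mktuple !tnth_beheadE.
Qed.

Lemma star_compE m p q (x : Omega R m p) (y : Omega R m q) g :
  star_comp x y (mk m (p + q.+1) g) =
  [forall i : 'I_m, g i p == Lc]%:R *
  ((-1) ^ (p.+1%:Z * tdeg (mk m q (gcirc p g)) + cross (mk m p g) (mk m q (gcirc p g))) *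
   (x (mk m p g) * y (mk m q (gcirc p g)))).
Proof.
rewrite /star_comp /bilext vec_sum (bigD1 (mk m p g)) //= addrC big1 ?add0r.
  rewrite vec_sum (bigD1 (mk m q (gcirc p g))) //= addrC big1 ?add0r.
    rewrite !vecZ mcircE vecZ deltaE [_ == _]eq_sym mcirc_eq !eqxx /= signzD.
    ring.
  move=> w /negPf vg.
  by rewrite !vecZ mcircE vecZ deltaE [_ == _]eq_sym mcirc_eq vg andbF /= !mulr0.
move=> v /negPf vg; rewrite vec_sum big1 // => w _.
by rewrite !vecZ mcircE vecZ deltaE [_ == _]eq_sym mcirc_eq vg /= !mulr0.
Qed.

Lemma ecast_mk m n n' (e : n' = n) (z : Omega R m n') g :
  (ecast k (Omega R m k) e z) (mk m n g) = z (mk m n' g).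
Proof. by case: n / e. Qed.

Lemma starE m (x y : Obar R m) n g :
  star x y n (mk m n g) = \sum_(p < n) [forall i : 'I_m, g i p == Lc]%:R *
  ((-1) ^ (p.+1%:Z * tdeg (mk m (n - p.+1) (gcirc p g)) +
           cross (mk m p g) (mk m (n - p.+1) (gcirc p g))) *
   (x p (mk m p g) * y (n - p.+1)%N (mk m (n - p.+1) (gcirc p g)))).
Proof.
by rewrite /star vec_sum; apply: eq_bigr => p _; rewrite ecast_mk star_compE.
Qed.

Definition gupd (g : nat -> nat -> letter) i j y i' j' :=
  if (i' == i) && (j' == j) then y else g i' j'.

Lemma linext_mpartialE m n (x : Omega R m n) g :
  linext (@mpartial R m n) x (mk m n g) =
  \sum_(i < m) \sum_(j < n)
    (-1) ^ (\sum_(k < m | (k < i)%N) lword (mkw n (g k)) +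
            \sum_(k < n | (k < j)%N) lword [tuple g i k]) *
    \sum_y wpartial_letter R y (g i j) * x (mk m n (gupd g i j y)).
Proof.
rewrite /mpartial leibnizE; apply: eq_bigr => i _.
transitivity ((-1) ^ (\sum_(k < m | (k < i)%N) lword (mkw n (g k))) *
  linext (@wpartial R n) [ffun w => x (tupd (mk m n g) i w)] (mkw n (g i))).
  congr (_ ^ _ * _); first by apply: eq_bigr => k _; rewrite tnth_mk.
  by rewrite linextE tnth_mk; apply: eq_bigr => w _; rewrite ffunE mulrC.
rewrite /wpartial leibnizE mulr_sumr; apply: eq_bigr => j _.
rewrite signzD -mulrA; congr (_ * (_ ^ _ * _)).
  by apply: eq_bigr => k _; rewrite tnth_mkw.
apply: eq_bigr => y _; rewrite tnth_mkw ffunE; congr (_ * x _).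
apply: eq_from_tnth => k; rewrite tnth_mktuple !tnth_mk.
apply: eq_from_tnth => h; rewrite tnth_mkw /gupd.
by rewrite !val_eqE; case: eqVneq => [->|ki] /=; rewrite ?tnth_mktuple tnth_mkw.
Qed.

(** The part of dtot which inserts letters a. *)
Definition coface m (x : Obar R m) : Obar R m := fun p =>
  match p with
  | 0 => 0
  | q.+1 => linext (fun t : mword m q =>
       (-1) ^ tdeg t *: \sum_(j < q.+1) (-1) ^+ j.+1 *: mface R j t) (x q)
  end.

Lemma cofaceSE m (x : Obar R m) q g : coface x q.+1 (mk m q.+1 g) =
  \sum_(j < q.+1) [forall i : 'I_m, g i j == La]%:R *
   ((-1) ^+ j.+1 * (-1) ^ tdeg (mk m q (fun i k => g i (bump j k))) *
    x q (mk m q (fun i k => g i (bump j k)))).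
Proof.
rewrite linextE; under eq_bigr => t _ do rewrite vecZ vec_sum !mulr_sumr.
rewrite exchange_big; apply: eq_bigr => j _ /=.
rewrite (bigD1 (mk m q (fun i k => g i (bump j k)))) //= big1 ?addr0; last first.
  move=> t /negPf tg.
  by rewrite vecZ deltaE [_ == _]eq_sym mface_eq tg /= !mulr0.
rewrite vecZ deltaE [_ == _]eq_sym mface_eq eqxx /=; ring.
Qed.

Lemma dtotE m (x : Obar R m) p :
  dtot x p = linext (@mpartial R m p) (x p) + coface x p.
Proof. by []. Qed.

End Coordinates.

(** * From rows to columns *)

Section Signs.
Variable R : realType.

Lemma signz_nat (k : int) (n : nat) : (exists h, k = n%:Z + 2 * h) ->
  (-1) ^ k = (-1) ^+ n :> R.
Proof.
case=> h ->; rewrite signzD; have -> : 2 * h = h + h by ring.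
by rewrite signzD signz_sq mulr1.
Qed.

Lemma signn_eq (n n' : nat) : odd n = odd n' -> (-1) ^+ n = (-1) ^+ n' :> R.
Proof. by move=> e; rewrite -[LHS]signr_odd e signr_odd. Qed.

End Signs.

Section Columns.
Variables (R : realType) (m : nat).
Implicit Types (s : seq (word m)) (c : word m) (x y : Obar R m).

Definition cola : word m := [tuple of nseq m La].
Definition colc : word m := [tuple of nseq m Lc].

Definition cgrid s i j : letter := nth La (nth cola s j) i.

Definition rowb s i : nat := \sum_(c <- s) (nth La c i == Lb).

Definition numb s : nat := \sum_(i < m) rowb s i.

Definition crossn s s' : nat :=
  \sum_(i < m) \sum_(k < m | (k < i)%N) (rowb s i * rowb s' k)%N.

(** Exponent of the sign which compares two readings of a word of Omega_m: row
    by row, with all symbols of degree 1 split off, and column by column, with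
    such a symbol in front of each column and one at the end.  The term crossn
    is due to the transposition of rows and columns; the last three terms move
    the symbol in front of c to the end, past everything else. *)
Fixpoint colsign s : nat :=
  match s with
  | [::] => 0
  | c :: s' => (colsign s' + crossn [:: c] s' + (size s').+1 + numb [:: c] +
                numb s')%N
  end.

(** The isomorphism of Obar with series over the alphabet of columns, under
    which all signs of the product disappear. *)
Definition series x s : R :=
  (-1) ^+ colsign s * x (size s) (mk m (size s) (cgrid s)).

Lemma rowb_cat s s' i : rowb (s ++ s') i = (rowb s i + rowb s' i)%N.
Proof. by rewrite /rowb big_cat. Qed.

Lemma numb_cat s s' : numb (s ++ s') = (numb s + numb s')%N.
Proof.
by rewrite /numb -big_split; apply: eq_bigr => i _; rewrite rowb_cat.
Qed.

Lemma crossn_catl s1 s2 s' :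
  crossn (s1 ++ s2) s' = (crossn s1 s' + crossn s2 s')%N.
Proof.
rewrite /crossn -big_split; apply: eq_bigr => i _ /=.
by rewrite -big_split; apply: eq_bigr => k _ /=; rewrite rowb_cat mulnDl.
Qed.

Lemma crossn_catr s1 s2 s' :
  crossn s' (s1 ++ s2) = (crossn s' s1 + crossn s' s2)%N.
Proof.
rewrite /crossn -big_split; apply: eq_bigr => i _ /=.
by rewrite -big_split; apply: eq_bigr => k _ /=; rewrite rowb_cat mulnDr.
Qed.

Lemma rowb_nil i : rowb [::] i = 0%N. Proof. by rewrite /rowb big_nil. Qed.

Lemma crossn0l s : crossn [::] s = 0%N.
Proof. by rewrite /crossn big1 // => i _; rewrite big1 // => k _; rewrite rowb_nil. Qed.

Lemma crossn0r s : crossn s [::] = 0%N.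
Proof.
by rewrite /crossn big1 // => i _; rewrite big1 // => k _; rewrite rowb_nil muln0.
Qed.

Lemma numb0 : numb [::] = 0%N.
Proof. by rewrite /numb big1 // => i _; rewrite rowb_nil. Qed.

(** Apart from the crossings of rows, the only interaction of the two halves is
    that each symbol of degree 1 in s has to pass s'. *)
Lemma colsign_cat s s' : colsign (s ++ s') =
  (colsign s + colsign s' + crossn s s' + size s * (size s' + numb s'))%N.
Proof.
elim: s => [|c s IH] /=; first by rewrite crossn0l mul0n !addn0.
rewrite IH size_cat -[c :: s]cat1s crossn_catr crossn_catl numb_cat; nia.
Qed.

Lemma colsign_mid s c s' : colsign (s ++ c :: s') =
  (colsign s + colsign s' + (numb [:: c]).+1 + crossn [:: c] s' + crossn s [:: c] +
   crossn s s' + (size s).+1 * (size s' + numb s') + size s * (numb [:: c]).+1)%N.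
Proof.
rewrite colsign_cat -[c :: s']cat1s colsign_cat crossn_catr numb_cat /=.
rewrite crossn0r numb0; nia.
Qed.

Lemma lword_letter a : lword [tuple a] = - (a == Lb : nat)%:Z.
Proof. by rewrite /lword /= addn0. Qed.

Lemma lword_mkw n h : lword (mkw n h) = - (\sum_(j < n) (h j == Lb))%N%:Z.
Proof.
rewrite -sumdeg_lword /sumdeg.
under eq_bigr => j _ do rewrite tnth_mkw lword_letter.
by rewrite sumrN; congr (- _); rewrite (big_morph Posz PoszD (erefl _)).
Qed.

Lemma sum_col s (F : letter -> nat) i :
  (\sum_(j < size s) F (cgrid s i j) = \sum_(c <- s) F (nth La c i))%N.
Proof. by rewrite (big_nth cola) big_mkord. Qed.

Lemma lword_cgrid s i : lword (mkw (size s) (cgrid s i)) = - (rowb s i)%:Z.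
Proof. by rewrite lword_mkw (sum_col s (fun a => a == Lb : nat)). Qed.

Lemma sumNz (I : finType) (P : pred I) (F : I -> nat) :
  \sum_(i | P i) - (F i)%:Z = - (\sum_(i | P i) F i)%N%:Z.
Proof. by rewrite sumrN; congr (- _); rewrite (big_morph Posz PoszD (erefl _)). Qed.

Lemma lmword_cgrid s : lmword (mk m (size s) (cgrid s)) = - (numb s)%:Z.
Proof.
rewrite /lmword -sumNz; apply: eq_bigr => i _.
by rewrite tnth_mk lword_cgrid.
Qed.

Lemma lword_col c : lword c = - (numb [:: c])%:Z.
Proof.
rewrite -sumdeg_lword /sumdeg -sumNz; apply: eq_bigr => i _.
by rewrite lword_letter /rowb big_seq1 (tnth_nth La).
Qed.

Lemma tdeg_cgrid s :
  tdeg (mk m (size s) (cgrid s)) = (size s).+1%:Z - (numb s)%:Z.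
Proof. by rewrite /tdeg lmword_cgrid. Qed.

Lemma cross_cgrid s s' :
  cross (mk m (size s) (cgrid s)) (mk m (size s') (cgrid s')) = (crossn s s')%:Z.
Proof.
rewrite /cross /crossn (big_morph Posz PoszD (erefl _)); apply: eq_bigr => i _.
rewrite (big_morph Posz PoszD (erefl _)); apply: eq_bigr => k _.
by rewrite !tnth_mk !lword_cgrid mulrNN.
Qed.

Lemma ssignE s : ssign R (@lword m) s = (-1) ^+ (size s + numb s).
Proof.
elim: s => [|c s IH]; first by rewrite /= numb0.
rewrite /= -/(ssign _ _ s) IH lword_col -[c :: s]cat1s numb_cat.
rewrite (@signz_nat _ _ (numb [:: c])); last by exists (- (numb [:: c])%:Z); lia.
by rewrite addSn exprS !exprD; ring.
Qed.

Lemma series_at x s n : size s = n ->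
  x n (mk m n (cgrid s)) = (-1) ^+ colsign s * series x s.
Proof. by move=> <-; rewrite /series signrMK. Qed.

Lemma cgrid_l s1 s2 i j : (j < size s1)%N -> cgrid (s1 ++ s2) i j = cgrid s1 i j.
Proof. by move=> js; rewrite /cgrid nth_cat js. Qed.

Lemma cgrid_r s1 s2 i j : cgrid (s1 ++ s2) i (size s1 + j)%N = cgrid s2 i j.
Proof. by rewrite /cgrid nth_cat ltnNge leq_addr /= addKn. Qed.

Lemma cgrid_mid s1 c s2 i : cgrid (s1 ++ c :: s2) i (size s1) = nth La c i.
Proof. by rewrite -[size s1]addn0 cgrid_r. Qed.

Lemma colP c a : (c == [tuple of nseq m a]) =
  [forall i : 'I_m, nth La c i == a].
Proof.
apply/eqP/forallP => [-> i|e]; first by rewrite nth_nseq ltn_ord.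
by apply: eq_from_tnth => i; rewrite !(tnth_nth La) (eqP (e i)) nth_nseq ltn_ord.
Qed.

Lemma split_nth s j : (j < size s)%N ->
  s = take j s ++ nth cola s j :: drop j.+1 s.
Proof. by move=> js; rewrite -drop_nth // cat_take_drop. Qed.

(** The sign of the product is exactly the defect of multiplicativity of
    colsign when a word is cut at a column without b. *)
Lemma star_term x y s1 c s2 p q : size s1 = p -> size s2 = q ->
  (-1) ^+ colsign (s1 ++ c :: s2) *
  ([forall i : 'I_m, cgrid (s1 ++ c :: s2) i p == Lc]%:R *
   ((-1) ^ (p.+1%:Z * tdeg (mk m q (gcirc p (cgrid (s1 ++ c :: s2)))) +
      cross (mk m p (cgrid (s1 ++ c :: s2))) (mk m q (gcirc p (cgrid (s1 ++ c :: s2))))) *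
   (x p (mk m p (cgrid (s1 ++ c :: s2))) *
    y q (mk m q (gcirc p (cgrid (s1 ++ c :: s2))))))) =
  (c == colc)%:R * (series x s1 * series y s2).
Proof.
move=> <- <-.
have -> : mk m (size s1) (cgrid (s1 ++ c :: s2)) = mk m (size s1) (cgrid s1).
  by apply: eq_mk => i j _ js; rewrite cgrid_l.
have -> : mk m (size s2) (gcirc (size s1) (cgrid (s1 ++ c :: s2))) =
    mk m (size s2) (cgrid s2).
  by apply: eq_mk => i j _ js; rewrite /gcirc addSnnS cgrid_r.
rewrite /colc colP; under eq_forallb do rewrite cgrid_mid.
case: forallP => [cc|_]; last by rewrite !mul0r mulr0.
have rc i : (i < m)%N -> rowb [:: c] i = 0%N.
  by move=> im; have /eqP /= e := cc (Ordinal im); rewrite /rowb big_seq1 e letter_eqE.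
rewrite tdeg_cgrid cross_cgrid.
rewrite (@signz_nat _ _ ((size s1).+1 * ((size s2).+1 + numb s2) + crossn s1 s2)%N);
  last by exists (- (size s1).+1%:Z * (numb s2)%:Z); lia.
rewrite !mul1r /series mulrA -exprD -mulrACA -exprD; congr (_ * _); apply: signn_eq.
rewrite colsign_mid.
have -> : numb [:: c] = 0%N by rewrite /numb big1 // => i _; rewrite rc.
have -> : crossn [:: c] s2 = 0%N.
  by rewrite /crossn big1 // => i _; rewrite big1 // => k _; rewrite rc.
have -> : crossn s1 [:: c] = 0%N.
  by rewrite /crossn big1 // => i _; rewrite big1 // => k _; rewrite rc ?muln0.
lia.
Qed.

Lemma series_star x y s : series (star x y) s = smul colc (series x) (series y) s.
Proof.
rewrite {1}/series starE (smulE cola) mulr_sumr; apply: eq_bigr => j _.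
have js := ltn_ord j.
rewrite -(star_term x y (nth cola s j) (size_takel (ltnW js)) (size_drop j.+1 s)).
by rewrite -split_nth.
Qed.

(** Inserting a column a...a changes colsign by the number of all symbols of
    degree 1 and of the letters b behind that column. *)
Lemma coface_term x s1 c s2 j n : size s1 = j -> size (s1 ++ s2) = n ->
  (-1) ^+ colsign (s1 ++ c :: s2) *
  ([forall i : 'I_m, cgrid (s1 ++ c :: s2) i j == La]%:R *
   ((-1) ^+ j.+1 *
    (-1) ^ tdeg (mk m n (fun i k => cgrid (s1 ++ c :: s2) i (bump j k))) *
    x n (mk m n (fun i k => cgrid (s1 ++ c :: s2) i (bump j k))))) =
  - (ssign R (@lword m) s1 * ((c == cola)%:R * series x (s1 ++ s2))).
Proof.
move=> <- <-.
have -> : mk m (size (s1 ++ s2))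
    (fun i k => cgrid (s1 ++ c :: s2) i (bump (size s1) k)) =
    mk m (size (s1 ++ s2)) (cgrid (s1 ++ s2)).
  apply: eq_mk => i k _ _; rewrite /cgrid !nth_cat /bump.
  case: (ltnP k (size s1)) => ks; first by rewrite ks.
  by rewrite add1n ltnNge (leq_trans ks (leqnSn k)) /= subSn.
rewrite /cola colP; under eq_forallb do rewrite cgrid_mid.
case: forallP => [cc|_]; last by rewrite !mul0r !mulr0 oppr0.
have rc i : (i < m)%N -> rowb [:: c] i = 0%N.
  move=> im; have /eqP /= e := cc (Ordinal im).
  by rewrite /rowb big_seq1 e letter_eqE.
rewrite tdeg_cgrid ssignE.
rewrite (@signz_nat _ _ ((size (s1 ++ s2)).+1 + numb (s1 ++ s2))%N);
  last by exists (- (numb (s1 ++ s2))%:Z); lia.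
rewrite !mul1r /series !mulrA -[RHS]mulNr; congr (_ * _).
rewrite -!exprD -[RHS]mulN1r -exprS; apply: signn_eq.
rewrite colsign_mid colsign_cat size_cat numb_cat.
have -> : numb [:: c] = 0%N by rewrite /numb big1 // => i _; rewrite rc.
have -> : crossn [:: c] s2 = 0%N.
  by rewrite /crossn big1 // => i _; rewrite big1 // => k _; rewrite rc.
have -> : crossn s1 [:: c] = 0%N.
  by rewrite /crossn big1 // => i _; rewrite big1 // => k _; rewrite rc ?muln0.
lia.
Qed.

Definition above s i : nat := \sum_(k < m | (k < i)%N) rowb s k.
Definition below s i : nat := \sum_(k < m | (i < k)%N) rowb s k.

Lemma numb_split s (i : 'I_m) : numb s = (above s i + rowb s i + below s i)%N.
Proof.
rewrite /numb (bigD1 i) //= /above /below.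
rewrite (bigID (fun k : 'I_m => (k < i)%N)) /=.
rewrite (eq_bigl (fun k : 'I_m => (k < i)%N)); last by move=> k; rewrite -val_eqE /=; lia.
rewrite [X in (_ + (_ + X))%N](eq_bigl (fun k : 'I_m => (i < k)%N));
  last by move=> k; rewrite -val_eqE /=; lia.
lia.
Qed.

Section Update.
Variables (c : word m) (i : 'I_m).
Hypothesis ci : tnth c i != Lb.

Lemma rowb_tupd (k : 'I_m) :
  rowb [:: tupd c i Lb] k = (rowb [:: c] k + (k == i))%N.
Proof.
rewrite /rowb !big_seq1 -!(tnth_nth La _ k) tnth_mktuple.
by have [->|_] := eqVneq k i; rewrite ?addn0 // (negPf ci) eqxx.
Qed.

Lemma numb_tupd : numb [:: tupd c i Lb] = (numb [:: c]).+1.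
Proof.
rewrite /numb; under eq_bigr do rewrite rowb_tupd.
rewrite big_split -addn1; congr (_ + _)%N.
by rewrite (bigD1 i) //= eqxx big1 // => k /negPf ->.
Qed.

Lemma crossn_tupdl s : crossn [:: tupd c i Lb] s = (crossn [:: c] s + above s i)%N.
Proof.
rewrite /crossn /above.
under eq_bigr => k _ do under eq_bigr do rewrite rowb_tupd mulnDl.
under eq_bigr => k _ do rewrite big_split /=.
rewrite big_split /=; congr (_ + _)%N.
rewrite (bigD1 i) //= [X in (_ + X)%N]big1 ?addn0.
  by apply: eq_bigr => k _; rewrite eqxx mul1n.
by move=> k /negPf ki; rewrite big1 // => h _; rewrite ki.
Qed.

Lemma crossn_tupdr s : crossn s [:: tupd c i Lb] = (crossn s [:: c] + below s i)%N.
Proof.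
rewrite /crossn /below.
under eq_bigr => k _ do under eq_bigr do rewrite rowb_tupd mulnDr.
under eq_bigr => k _ do rewrite big_split /=.
rewrite big_split /=; congr (_ + _)%N.
rewrite [RHS]big_mkcond; apply: eq_bigr => k _.
case: ifP => ik; last first.
  rewrite big1 // => h hk; case: eqVneq => [hi|_]; rewrite ?muln0 //.
  by rewrite -hi hk in ik.
rewrite (bigD1 i) //= eqxx muln1 big1 ?addn0 // => h /andP[_ /negPf ->].
by rewrite muln0.
Qed.

End Update.

Lemma nth_tupd c (i : 'I_m) (b : letter) k : (k < m)%N ->
  nth La (tupd c i b) k = if k == i then b else nth La c k.
Proof.
move=> km; have := tnth_mktuple (fun j => if j == i then b else tnth c j) (Ordinal km).
by rewrite -val_eqE !(tnth_nth La) /= => ->.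
Qed.

Lemma wpartial_letter_neq0 (a b : letter) :
  wpartial_letter R a b != 0 -> a = Lb /\ b != Lb.
Proof.
case: a b => [] [] /=; rewrite ?vecE ?deltaE ?letter_eqE ?eqxx //=.
by rewrite subrr eqxx.
Qed.

(** Turning a letter into b at row i of the column c changes colsign by the
    letters b of s1 below row i, those of s2 above row i, and the symbols of
    degree 1 up to that column.  This is the difference between what precedes
    the letter row by row and column by column. *)
Lemma partial_term x s1 c s2 (i : 'I_m) j n : size s1 = j ->
  size (s1 ++ c :: s2) = n ->
  (-1) ^+ colsign (s1 ++ c :: s2) *
  ((-1) ^ (\sum_(k < m | (k < i)%N) lword (mkw n (cgrid (s1 ++ c :: s2) k)) +
    \sum_(k < n | (k < j)%N) lword [tuple cgrid (s1 ++ c :: s2) i k]) *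
    \sum_y wpartial_letter R y (cgrid (s1 ++ c :: s2) i j) *
      x n (mk m n (gupd (cgrid (s1 ++ c :: s2)) i j y))) =
  - (ssign R (@lword m) s1 *
     ((-1) ^ (\sum_(k < m | (k < i)%N) lword [tuple tnth c k]) *
      \sum_y wpartial_letter R y (tnth c i) * series x (s1 ++ tupd c i y :: s2))).
Proof.
move=> <- <-; rewrite -mulNr !mulrA !mulr_sumr; apply: eq_bigr => y _.
rewrite cgrid_mid -tnth_nth.
have [->|/wpartial_letter_neq0[-> ci]] :=
  eqVneq (wpartial_letter R y (tnth c i)) 0; first by rewrite !mul0r !mulr0.
have -> : mk m (size (s1 ++ c :: s2)) (gupd (cgrid (s1 ++ c :: s2)) i (size s1) Lb)
    = mk m (size (s1 ++ c :: s2)) (cgrid (s1 ++ tupd c i Lb :: s2)).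
  apply: eq_mk => i' j' im _; rewrite /gupd.
  have [js|js|->] := ltngtP j' (size s1).
  - by rewrite andbF !cgrid_l.
  - rewrite andbF -(subnKC js) addSnnS !cgrid_r.
    by rewrite /cgrid.
  - by rewrite andbT !cgrid_mid nth_tupd.
rewrite (@series_at x (s1 ++ tupd c i Lb :: s2)); last by rewrite !size_cat.
under eq_bigr do rewrite lword_cgrid.
rewrite sumNz -/(above _ _).
rewrite (_ : \sum_(k < _ | (k < size s1)%N) _ = - (rowb s1 i)%:Z); last first.
  have -> : rowb s1 i = (\sum_(k < size s1) (cgrid s1 i k == Lb))%N.
    by rewrite (sum_col s1 (fun a => a == Lb : nat)).
  rewrite -sumNz size_cat.
  rewrite big_split_ord /= [X in _ + X]big_pred0 ?addr0; last by move=> k; lia.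
  apply: eq_big => k; first by rewrite ltn_ord.
  by rewrite lword_letter cgrid_l.
rewrite (_ : \sum_(k < m | (k < i)%N) _ = - (above [:: c] i)%:Z); last first.
  rewrite -sumNz; apply: eq_bigr => k _.
  by rewrite lword_letter /rowb big_seq1 (tnth_nth La).
rewrite ssignE.
rewrite (@signz_nat _ _ (above (s1 ++ c :: s2) i + rowb s1 i)); last first.
  by exists (- (above (s1 ++ c :: s2) i)%:Z - (rowb s1 i)%:Z); lia.
rewrite (@signz_nat _ _ (above [:: c] i)); last first.
  by exists (- (above [:: c] i)%:Z); lia.
rewrite [wpartial_letter _ _ _ * (_ * _)]mulrCA [LHS]mulrA; congr (_ * _).
rewrite mulNr -[RHS]mulN1r -!exprD -exprS; apply: signn_eq.
have -> : above (s1 ++ c :: s2) i = (above s1 i + above [:: c] i + above s2 i)%N.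
  rewrite /above -!big_split; apply: eq_bigr => k _ /=.
  by rewrite rowb_cat -[c :: s2]cat1s rowb_cat addnA.
rewrite !colsign_mid numb_tupd // crossn_tupdl // crossn_tupdr // (numb_split s1 i).
lia.
Qed.

Definition colpartial (v c : word m) : R := wpartial R v c.

Lemma cofaceE x n g : coface x n (mk m n g) =
  \sum_(j < n) [forall i : 'I_m, g i j == La]%:R *
   ((-1) ^+ j.+1 * (-1) ^ tdeg (mk m n.-1 (fun i k => g i (bump j k))) *
    x n.-1 (mk m n.-1 (fun i k => g i (bump j k)))).
Proof. by case: n => [|n]; [rewrite big_ord0 vec0 | rewrite cofaceSE]. Qed.

Lemma series_dtot x s :
  series (dtot x) s = sdiff (@lword m) colpartial cola (series x) s.
Proof.
rewrite {1}/series dtotE vecD linext_mpartialE cofaceE exchange_big sdiffE.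
rewrite -big_split mulr_sumr -sumrN; apply: eq_bigr => j _ /=.
have js := ltn_ord j.
have sz1 := size_takel (ltnW js).
have szs : size (take j s ++ drop j.+1 s) = (size s).-1.
  by rewrite size_cat sz1 size_drop; lia.
rewrite mulrDr addrC mulrDr opprD.
have := coface_term x (nth cola s j) sz1 szs; rewrite -split_nth // => ->.
congr (_ + _).
rewrite mulr_sumr.
transitivity (- (ssign R (@lword m) (take j s) *
    linext (@wpartial R m) [ffun v => series x (take j s ++ v :: drop j.+1 s)]
      (nth cola s j))); last first.
  congr (- (_ * _)); rewrite linextE; apply: eq_bigr => v _.
  by rewrite ffunE mulrC.
rewrite /wpartial leibnizE mulr_sumr -sumrN; apply: eq_bigr => i _.
have szs' : size (take j s ++ nth cola s j :: drop j.+1 s) = size s.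
  by rewrite -split_nth.
have := partial_term x i sz1 szs'; rewrite -split_nth // => ->.
by congr (- (_ * (_ * _))); apply: eq_bigr => y _; rewrite ffunE.
Qed.

(** Every m-tuple of words is the transpose of its sequence of columns. *)
Lemma series_inj x y : series x = series y -> x = y.
Proof.
move=> xy; apply: functional_extensionality_dep => p; apply/ffunP => t.
pose s := mkseq (fun j => [tuple nth La (tnth t i) j | i < m] : word m) p.
have sz : size s = p by rewrite size_mkseq.
have -> : t = mk m p (cgrid s).
  apply: eq_from_tnth => i; rewrite tnth_mk; apply: eq_from_tnth => j.
  rewrite tnth_mkw /cgrid nth_mkseq // -(tnth_nth La _ i) tnth_mktuple.
  by rewrite (tnth_nth La).
by rewrite !series_at // xy.
Qed.

Lemma wpartial_nob (c : word m) : (forall i, tnth c i != Lb) -> wpartial R c = 0.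
Proof.
move=> cb; apply/ffunP => t; rewrite vec0 /wpartial leibniz_coef big1 // => i _.
have [->|/wpartial_letter_neq0[ci _]] :=
  eqVneq (wpartial_letter R (tnth c i) (tnth t i)) 0; first by rewrite mul0r mulr0.
by have := cb i; rewrite ci eqxx.
Qed.

Lemma lword_nob (c : word m) : (forall i, tnth c i != Lb) -> lword c = 0.
Proof.
move=> cb; rewrite lword_col /numb big1 // => i _.
by rewrite /rowb big_seq1 -tnth_nth (negPf (cb i)).
Qed.

Lemma cola_nob i : tnth cola i != Lb.
Proof. by rewrite (tnth_nth La) nth_nseq ltn_ord letter_eqE. Qed.

Lemma colc_nob i : tnth colc i != Lb.
Proof. by rewrite (tnth_nth La) nth_nseq ltn_ord letter_eqE. Qed.

Lemma colpartial_deg v c : colpartial v c != 0 -> lword c = lword v + 1.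
Proof. exact: (ctr_deg_d (word_contraction R m)). Qed.

Lemma colpartial_sq u c : \sum_v colpartial v c * colpartial u v = 0.
Proof.
rewrite -[RHS](vec0 R c) -(ctr_dd (word_contraction R m) u) linextE.
by apply: eq_bigr => w _; rewrite mulrC.
Qed.

(** * The differential graded algebra *)

(** The parity involution; it states the Leibniz rule for all elements at once,
   homogeneous or not. *)
Definition grade x : Obar R m := fun p => twist (@tdeg m p) (x p).

Lemma series_grade x s : series (grade x) s = sgrade (@lword m) (series x) s.
Proof.
rewrite /sgrade /series ffunE tdeg_cgrid ssignE.
rewrite (@signz_nat _ _ ((size s).+1 + numb s)); last by exists (- (numb s)%:Z); lia.
by rewrite addSn exprS; ring.
Qed.

Lemma seriesD x y s : series (x + y) s = series x s + series y s.
Proof. by rewrite /series vecD mulrDr. Qed.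

Lemma starA x y z : star (star x y) z = star x (star y z).
Proof.
apply: series_inj; apply/funext => s.
rewrite !series_star (funext (series_star x y)) (funext (series_star y z)).
exact: smulA.
Qed.

Lemma dtot_dtot x : dtot (dtot x) = 0.
Proof.
apply: series_inj; apply/funext => s.
rewrite series_dtot (funext (series_dtot x)) sdiff_sdiff.
- by rewrite /series vec0 mulr0.
- exact: colpartial_deg.
- exact: colpartial_sq.
- by move=> v; rewrite /colpartial wpartial_nob ?vec0 //; apply: cola_nob.
- by apply: lword_nob; apply: cola_nob.
Qed.

Lemma dtot_star x y : dtot (star x y) = star (dtot x) y + star (grade x) (dtot y).
Proof.
apply: series_inj; apply/funext => s.
rewrite series_dtot (funext (series_star x y)) seriesD !series_star.
rewrite (funext (series_dtot x)) (funext (series_dtot y)) (funext (series_grade x)).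
apply: sdiff_smul.
- by move=> v; rewrite /colpartial wpartial_nob ?vec0 //; apply: colc_nob.
- by apply: lword_nob; apply: colc_nob.
Qed.

End Columns.

(** * The symmetric group action *)

Lemma lword_mkw_circ n p h : (p < n)%N -> h p != Lb ->
  lword (mkw n h) =
  lword (mkw p h) + lword (mkw (n - p.+1) (fun j => h (p.+1 + j)%N)).
Proof.
move=> pn hp; rewrite !lword_mkw -opprD -PoszD; congr (- Posz _).
rewrite -(big_mkord xpredT (fun j => (h j == Lb) : nat)).
rewrite (big_cat_nat (leq0n p)) ?(ltnW pn) //=.
rewrite big_mkord (big_ltn pn) (negPf hp) add0n; congr (_ + _)%N.
rewrite -[X in (\sum_(X <= _ < _) _)%N]add0n big_addn big_mkord.
by apply: eq_bigr => j _; rewrite addnC.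
Qed.

Lemma lword_mkw_face n (j : 'I_n) (h : nat -> letter) : h j != Lb ->
  lword (mkw n h) = lword (mkw n.-1 (fun k => h (bump j k))).
Proof.
case: n j => [[]//|n] j hj; rewrite !lword_mkw; congr (- Posz _).
by rewrite (bigD1_ord j) //= (negPf hj).
Qed.

Lemma lword_mkw_upd n (j : 'I_n) (h : nat -> letter) : h j != Lb ->
  lword (mkw n (fun k => if k == j then Lb else h k)) = lword (mkw n h) - 1.
Proof.
move=> hj; rewrite !lword_mkw -opprD -(PoszD _ 1); congr (- Posz _).
rewrite (bigD1 j) //= eqxx [in RHS](bigD1 j) //= (negPf hj) eqxx add0n addnC.
congr (_ + _)%N; apply: eq_bigr => k kj.
by rewrite (negPf (_ : k != j :> nat)).
Qed.

Lemma mk_surj m n (t : mword m n) : exists g, t = mk m n g.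
Proof.
exists (fun i j => nth La (nth [tuple of nseq n La] t i) j).
apply: eq_from_tnth => i; rewrite tnth_mk; apply: eq_from_tnth => j.
by rewrite tnth_mkw -!tnth_nth.
Qed.

Section KoszulForm.
Variables (m : nat) (s : 'S_m).
Implicit Types u v : 'I_m -> int.

Definition koszul_form u : int :=
  \sum_(i < m) \sum_(j < m | (i < j)%N && (s j < s i)%N) u i * u j.

(** The defect of additivity of the Koszul exponent is the change of the sign
    of a product when its factors are reordered. *)
Lemma koszul_formD u v :
  koszul_form (fun i => u i + v i) + \sum_(i < m) \sum_(k < m | (k < i)%N) u i * v k =
  koszul_form u + koszul_form v +
  \sum_(i < m) \sum_(k < m | (s k < s i)%N) u i * v k +
  2 * \sum_(i < m) \sum_(k < m | (k < i)%N && (s i < s k)%N) u i * v k.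
Proof.
have mk2 (P : 'I_m -> 'I_m -> bool) (F : 'I_m -> 'I_m -> int) :
    \sum_(i < m) \sum_(k < m | P i k) F i k =
    \sum_(q : 'I_m * 'I_m) if P q.1 q.2 then F q.1 q.2 else 0.
  by rewrite pair_big_dep big_mkcond.
have swap : \sum_(i < m) \sum_(k < m | (i < k)%N && (s k < s i)%N) u k * v i =
    \sum_(i < m) \sum_(k < m | (k < i)%N && (s i < s k)%N) u i * v k.
  by rewrite (exchange_big_dep xpredT).
have -> : koszul_form (fun i => u i + v i) = koszul_form u + koszul_form v +
    (\sum_(i < m) \sum_(k < m | (i < k)%N && (s k < s i)%N) u i * v k +
     \sum_(i < m) \sum_(k < m | (k < i)%N && (s i < s k)%N) u i * v k).
  rewrite -swap /koszul_form !mk2 -!big_split; apply: eq_bigr => q _ /=.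
  by case: ifP => _; ring.
rewrite -!addrA; congr (_ + (_ + _)).
rewrite mulr_natl mulr2n !mk2 -!big_split; apply: eq_bigr => -[i k] _ /=.
have : (i == k) || (s i != s k :> nat).
  by rewrite (inj_eq val_inj) (inj_eq perm_inj) orbN.
case: (ltngtP i k) => [ik|ki|/val_inj ->]; rewrite ?ltnn /= ?addr0 //;
  rewrite -val_eqE /= ?(gtn_eqF ik) ?(ltn_eqF ik) ?(gtn_eqF ki) ?(ltn_eqF ki) /=;
  by case: ltngtP => //= _ _; rewrite ?addr0 ?add0r.
Qed.

End KoszulForm.

Section Equivariance.
Variables (R : realType) (m : nat) (s : 'S_m).
Implicit Types (x y : Obar R m) (g : nat -> nat -> letter).

(** Rows outside the range stay where they are, so that gperm commutes with the
    other operations on grids. *)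
Definition gperm g i : nat -> letter :=
  if insub i is Some i' then g (s (i' : 'I_m)) else g i.

Lemma gpermE g (i : 'I_m) : gperm g i = g (s i).
Proof. by rewrite /gperm valK. Qed.

Definition rowdeg n g (i : 'I_m) : int := lword (mkw n (g i)).

Lemma mpermV_mk n g : mperm (s^-1)%g (mk m n g) = mk m n (gperm g).
Proof.
by apply: eq_from_tnth => i; rewrite tnth_mktuple invgK !tnth_mk gpermE.
Qed.

Lemma act_compE n (x : Omega R m n) g : act_comp s x (mk m n g) =
  (-1) ^ koszul_form s (rowdeg n (gperm g)) * x (mk m n (gperm g)).
Proof.
rewrite /act_comp linextE (bigD1 (mk m n (gperm g))) //= big1 ?addr0.
  rewrite vecZ deltaE -mpermV_mk.
  have -> : mperm s (mperm (s^-1)%g (mk m n g)) = mk m n g.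
    by apply: eq_from_tnth => i; rewrite !tnth_mktuple invgK permKV.
  rewrite eqxx mulr1 mulrC; congr ((-1) ^ _ * _).
  rewrite /koszul; apply: eq_bigr => i _; apply: eq_bigr => j _.
  by rewrite mpermV_mk !tnth_mk.
move=> t tg; rewrite vecZ deltaE; have [e|_] := eqVneq; last by rewrite !mulr0.
case/eqP: tg; rewrite -mpermV_mk e.
by apply: eq_from_tnth => i; rewrite !tnth_mktuple invgK permK.
Qed.

Lemma lmword_mk n g : lmword (mk m n g) = \sum_(i < m) rowdeg n g i.
Proof. by apply: eq_bigr => i _; rewrite tnth_mk. Qed.

Lemma tdeg_gperm n g : tdeg (mk m n (gperm g)) = tdeg (mk m n g).
Proof.
rewrite /tdeg !lmword_mk [in RHS](reindex_inj (@perm_inj _ s)); congr (_ + _).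
by apply: eq_bigr => i _; rewrite /rowdeg gpermE.
Qed.

Lemma forall_gperm g (a : letter) j :
  [forall i : 'I_m, gperm g i j == a] = [forall i : 'I_m, g i j == a].
Proof.
apply/forallP/forallP => [gP i|gP i]; last by rewrite gpermE.
by have := gP ((s^-1)%g i); rewrite gpermE permKV.
Qed.

(** The Koszul sign is a quadratic form in the degrees of the factors; by
    koszul_formD its polarization is the difference of the signs of the
    product before and after the permutation. *)
Lemma act_star x y : Defs.act s (star x y) = star (Defs.act s x) (Defs.act s y).
Proof.
apply: functional_extensionality_dep => n; apply/ffunP => t.
have [g ->] := mk_surj t.
rewrite /Defs.act act_compE !starE mulr_sumr; apply: eq_bigr => p _.
rewrite /Defs.act !act_compE forall_gperm.
case: forallP => [cc|_]; last by rewrite !mul0r mulr0.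
have -> : gperm (gcirc p g) = gcirc p (gperm g).
  by apply/funext => i; rewrite /gcirc /gperm; case: insub.
rewrite !mul1r.
set X := x _ _; set Y := y _ _.
have -> : tdeg (mk m (n - p.+1) (gcirc p g)) =
          tdeg (mk m (n - p.+1) (gcirc p (gperm g))).
  rewrite -(tdeg_gperm _ (gcirc p g)); congr (tdeg (mk _ _ _)).
  by apply/funext => i; rewrite /gcirc /gperm; case: insub.
rewrite !signzD; set T := (-1) ^ (_ * _).
set u := rowdeg p (gperm g); set v := rowdeg (n - p.+1) (gcirc p (gperm g)).
have -> : koszul_form s (rowdeg n (gperm g)) = koszul_form s (fun i => u i + v i).
  apply: eq_bigr => i _; apply: eq_bigr => j _; rewrite /rowdeg.
  by rewrite !(@lword_mkw_circ n p) // gpermE (eqP (cc _)) letter_eqE.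
have -> : cross (mk m p (gperm g)) (mk m (n - p.+1) (gcirc p (gperm g))) =
    \sum_(i < m) \sum_(k < m | (k < i)%N) u i * v k.
  by apply: eq_bigr => i _; apply: eq_bigr => k _; rewrite !tnth_mk.
have -> : cross (mk m p g) (mk m (n - p.+1) (gcirc p g)) =
    \sum_(i < m) \sum_(k < m | (s k < s i)%N) u i * v k.
  rewrite /cross (reindex_inj (@perm_inj _ s)); apply: eq_bigr => i _ /=.
  rewrite (reindex_inj (@perm_inj _ s)); apply: eq_bigr => k _ /=.
  by rewrite !tnth_mk /u /v /rowdeg /gcirc !gpermE.
have := koszul_formD s u v => /(congr1 (fun k => (-1) ^ k : R)).
set A := \sum_i _; set B := \sum_(i < m) \sum_(k < m | (s k < s i)%N) _.
rewrite mulr_natl mulr2n !signzD signz_sq mulr1 => e.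
transitivity (((-1) ^ koszul_form s (fun i => u i + v i) * (-1) ^ A) * (T * (X * Y))).
  by ring.
by rewrite e; ring.
Qed.

(** The inserted column has no b, so neither the Koszul sign nor the total degree
    sees it. *)
Lemma coface_act x : Defs.act s (coface x) = coface (Defs.act s x).
Proof.
apply: functional_extensionality_dep => n; apply/ffunP => t.
have [g ->] := mk_surj t.
rewrite /Defs.act act_compE !cofaceE mulr_sumr; apply: eq_bigr => j _.
rewrite /Defs.act act_compE forall_gperm.
case: forallP => [cc|_]; last by rewrite !mul0r mulr0.
have -> : gperm (fun i k => g i (bump j k)) = (fun i k => gperm g i (bump j k)).
  by apply/funext => i; rewrite /gperm; case: insub.
have -> : tdeg (mk m n.-1 (fun i k => g i (bump j k))) =
          tdeg (mk m n.-1 (fun i k => gperm g i (bump j k))).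
  rewrite -(tdeg_gperm _ (fun i k => g i (bump j k))); congr (tdeg (mk _ _ _)).
  by apply/funext => i; rewrite /gperm; case: insub.
have -> : koszul_form s (rowdeg n (gperm g)) =
    koszul_form s (rowdeg n.-1 (fun i k => gperm g i (bump j k))).
  apply: eq_bigr => i _; apply: eq_bigr => k _; rewrite /rowdeg.
  by rewrite !(lword_mkw_face (j := j)) // gpermE (eqP (cc _)) letter_eqE.
by ring.
Qed.

(** Lowering the degree of one factor by 1 changes the Koszul sign by the signs
   of moving that degree to its place before and after the permutation. *)
Lemma sign_koszul_form_pred (u u' : 'I_m -> int) i :
  (forall k, u' k = u k - (k == i)%:R) ->
  (-1) ^ koszul_form s u * (-1) ^ (\sum_(k < m | (k < i)%N) u k) =
  (-1) ^ koszul_form s u' * (-1) ^ (\sum_(k < m | (s k < s i)%N) u k) :> R.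
Proof.
move=> uu; pose d k : int := - (k == i)%:R.
have dsum (P : 'I_m -> 'I_m -> bool) :
    \sum_(h < m) \sum_(k < m | P h k) d h * u k = - \sum_(k < m | P i k) u k.
  rewrite (bigD1 i) //= addrC big1 ?add0r.
    by rewrite -sumrN; apply: eq_bigr => k _; rewrite /d eqxx mulN1r.
  by move=> h /negPf hi; rewrite big1 // => k _; rewrite /d hi mulNr mul0r oppr0.
have d0 : koszul_form s d = 0.
  rewrite /koszul_form big1 // => h _; rewrite big1 // => k /andP[hk _].
  rewrite /d; have [hi|_] := eqVneq h i; last by rewrite mulNr mul0r oppr0.
  have [ki|_] := eqVneq k i; last by rewrite mulrN mulr0 oppr0.
  by rewrite hi ki ltnn in hk.
have eu' : koszul_form s u' = koszul_form s (fun k => d k + u k).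
  by apply: eq_bigr => h _; apply: eq_bigr => k _; rewrite !uu /d ![- _ + _]addrC.
have := koszul_formD s d u => /(congr1 (fun k => (-1) ^ k : R)).
rewrite mulr_natl mulr2n !signzD signz_sq mulr1 d0 expr0z mul1r !dsum.
have signN (k : int) : (-1) ^ (- k) = (-1) ^ k :> R.
  transitivity ((-1) ^ k * (-1) ^ k * (-1) ^ (- k) : R); first by rewrite signz_sq mul1r.
  by rewrite -mulrA -signzD subrr expr0z mulr1.
rewrite -eu' !signN => e.
set A := (-1) ^ (\sum_(k < m | (k < i)%N) u k) in e *.
set B := (-1) ^ (\sum_(k < m | (s k < s i)%N) u k) in e *.
have -> : (-1) ^ koszul_form s u = (-1) ^ koszul_form s u' * A * B :> R.
  by rewrite e -mulrA signz_sq mulr1.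
by rewrite mulrAC -[_ * A * A]mulrA signz_sq mulr1.
Qed.

(** By linext_mpartialE the differential replaces one letter by b, in row s i
    on one side and in row i on the other; sign_koszul_form_pred compares the
    two signs. *)
Lemma partial_act p (x : Omega R m p) :
  act_comp s (linext (@mpartial R m p) x) = linext (@mpartial R m p) (act_comp s x).
Proof.
apply/ffunP => t; have [g ->] := mk_surj t.
rewrite act_compE !linext_mpartialE [RHS](reindex_inj (@perm_inj _ s)) mulr_sumr.
apply: eq_bigr => i _; rewrite mulr_sumr; apply: eq_bigr => j _ /=.
rewrite [in RHS](reindex_inj (@perm_inj _ s)) /= !mulr_sumr.
apply: eq_bigr => y _; rewrite gpermE.
have [->|/wpartial_letter_neq0[-> gij]] := eqVneq (wpartial_letter R y (g (s i) j)) 0.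
  by rewrite !mul0r !mulr0.
rewrite act_compE.
have e k : gperm (gupd g (s i) j Lb) (k : 'I_m) = gupd (gperm g) i j Lb k.
  by apply/funext => h; rewrite gpermE /gupd gpermE !val_eqE (inj_eq perm_inj).
have -> : mk m p (gperm (gupd g (s i) j Lb)) = mk m p (gupd (gperm g) i j Lb).
  by apply: eq_mk => i' h im _; rewrite -[i']/(val (Ordinal im)) e.
rewrite !signzD.
have -> : \sum_(k < m | (s k < s i)%N) lword (mkw p (g (s k))) =
   \sum_(k < m | (s k < s i)%N) rowdeg p (gperm g) k.
  by apply: eq_bigr => k _; rewrite /rowdeg gpermE.
have := @sign_koszul_form_pred (rowdeg p (gperm g))
   (rowdeg p (gperm (gupd g (s i) j Lb))) i.
rewrite /rowdeg => /(_ _)/= sk.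
set X := x _; set W := wpartial_letter R Lb (g (s i) j).
set L := (-1) ^ (\sum_(k < p | _) _).
rewrite [LHS](_ : _ = L * W * X * ((-1) ^ koszul_form s (rowdeg p (gperm g)) *
  (-1) ^ (\sum_(k < m | (k < i)%N) rowdeg p (gperm g) k))); last by rewrite /rowdeg; ring.
rewrite /rowdeg sk; last first.
  move=> k; rewrite e /gupd val_eqE.
  have [->|_] /= := eqVneq k i; last by rewrite subr0.
  by rewrite lword_mkw_upd // gpermE.
by ring.
Qed.

Lemma actD x y : Defs.act s (x + y) = Defs.act s x + Defs.act s y.
Proof. by apply: functional_extensionality_dep => p; apply: linextD. Qed.

End Equivariance.

(** * Bilinearity and degrees *)

Section Degrees.
Variables (R : realType) (m : nat).
Implicit Types (x y z w th : Obar R m).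

Lemma ObarP x y : (forall n g, x n (mk m n g) = y n (mk m n g)) -> x = y.
Proof.
move=> xy; apply: functional_extensionality_dep => n; apply/ffunP => t.
by have [g ->] := mk_surj t.
Qed.

Lemma obarD x y p : (x + y) p = x p + y p. Proof. by []. Qed.
Lemma obarN x p : (- x) p = - x p. Proof. by []. Qed.
Lemma obarZ (a : R) x p : (a *: x) p = a *: x p. Proof. by []. Qed.
Lemma obar0 p : (0 : Obar R m) p = 0. Proof. by []. Qed.

Definition obarE := (obarD, obarN, obarZ, obar0, vecE).

Lemma starDl x x' y : star (x + x') y = star x y + star x' y.
Proof.
apply: ObarP => n g; rewrite !obarE !starE -big_split; apply: eq_bigr => p _ /=.
by rewrite !obarE; ring.
Qed.

Lemma starDr x y y' : star x (y + y') = star x y + star x y'.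
Proof.
apply: ObarP => n g; rewrite !obarE !starE -big_split; apply: eq_bigr => p _ /=.
by rewrite !obarE; ring.
Qed.

Lemma starZl a x y : star (a *: x) y = a *: star x y.
Proof.
apply: ObarP => n g; rewrite !obarE !starE mulr_sumr; apply: eq_bigr => p _ /=.
by rewrite !obarE; ring.
Qed.

Lemma starZr a x y : star x (a *: y) = a *: star x y.
Proof.
apply: ObarP => n g; rewrite !obarE !starE mulr_sumr; apply: eq_bigr => p _ /=.
by rewrite !obarE; ring.
Qed.

Lemma starNl x y : star (- x) y = - star x y.
Proof. by rewrite -scaleN1r starZl scaleN1r. Qed.

Lemma starNr x y : star x (- y) = - star x y.
Proof. by rewrite -scaleN1r starZr scaleN1r. Qed.

Lemma star0l y : star 0 y = 0.
Proof. by have := starZl 0 0 y; rewrite !scale0r. Qed.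

Lemma star0r x : star x 0 = 0.
Proof. by have := starZr 0 x 0; rewrite !scale0r. Qed.

Lemma star_local x x' y y' n : (forall p, (p < n)%N -> x p = x' p) ->
  (forall p, (p < n)%N -> y p = y' p) -> star x y n = star x' y' n.
Proof.
move=> xx yy; apply: eq_bigr => p _.
by rewrite xx // yy //; have := ltn_ord p; lia.
Qed.

Lemma cofaceD x y : coface (x + y) = coface x + coface y.
Proof.
apply: functional_extensionality_dep => -[|p]; rewrite obarD /coface ?addr0 //.
exact: linextD.
Qed.

Lemma cofaceZ (a : R) x : coface (a *: x) = a *: coface x.
Proof.
apply: functional_extensionality_dep => -[|p]; rewrite obarZ /coface ?scaler0 //.
exact: linextZ.
Qed.

Lemma coface0 : coface (0 : Obar R m) = 0.
Proof. by have := cofaceZ 0 0; rewrite !scale0r. Qed.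

Lemma coface_local x y n : (forall p, (p < n)%N -> x p = y p) ->
  coface x n = coface y n.
Proof. by case: n => [|n] xy //; rewrite /coface (xy n (ltnSn n)). Qed.

Lemma dtotD x y : dtot (x + y) = dtot x + dtot y.
Proof.
apply: functional_extensionality_dep => p.
by rewrite obarD !dtotE cofaceD !obarD linextD addrACA.
Qed.

Lemma dtotZ (a : R) x : dtot (a *: x) = a *: dtot x.
Proof.
apply: functional_extensionality_dep => p.
by rewrite obarZ !dtotE cofaceZ !obarZ linextZ scalerDr.
Qed.

Lemma dtotN x : dtot (- x) = - dtot x.
Proof. by rewrite -scaleN1r dtotZ scaleN1r. Qed.

Lemma in_ObarP n x :
  in_Obar n x <-> forall p (t : mword m p), x p t != 0 -> tdeg t = n.
Proof.
split=> h p t nz; first by rewrite /tdeg (h _ _ nz); ring.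
by rewrite -(h _ _ nz) /tdeg; ring.
Qed.

Lemma in_ObarD n x y : in_Obar n x -> in_Obar n y -> in_Obar n (x + y).
Proof.
by move=> hx hy p t; rewrite !obarE => /addr_neq0[/hx|/hy].
Qed.

Lemma in_ObarZ n (a : R) x : in_Obar n x -> in_Obar n (a *: x).
Proof.
by move=> hx p t; rewrite !obarE mulf_eq0 negb_or => /andP[_ /hx].
Qed.

Lemma in_ObarN n x : in_Obar n x -> in_Obar n (- x).
Proof. by rewrite -scaleN1r; apply: in_ObarZ. Qed.

Lemma sum_neq0 (I : finType) (F : I -> R) : \sum_i F i != 0 -> exists i, F i != 0.
Proof.
move=> nz; apply/existsP; apply: contraNT nz => /existsPn h.
by rewrite big1 // => i _; apply/eqP; rewrite -[_ == _]negbK h.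
Qed.

Lemma in_Obar_star n n' x y : in_Obar n x -> in_Obar n' y ->
  in_Obar (n + n') (star x y).
Proof.
move=> /in_ObarP hx /in_ObarP hy; apply/in_ObarP => p t.
have [g ->] := mk_surj t; rewrite starE => /sum_neq0[q].
rewrite !mulf_eq0 !negb_or => /and4P[cc _ /hx <- /hy <-].
move: cc; case: forallP => [cc _|]; last by rewrite eqxx.
rewrite /tdeg !lmword_mk.
have -> : \sum_(i < m) rowdeg p g i =
  \sum_(i < m) (rowdeg q g i + rowdeg (p - q.+1) (gcirc q g) i).
  apply: eq_bigr => i _; rewrite /rowdeg (@lword_mkw_circ p q) //.
  by rewrite (eqP (cc _)) letter_eqE.
have -> : p.+1%:Z = q.+1%:Z + (p - q.+1).+1%:Z by have := ltn_ord q; lia.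
by rewrite big_split /=; ring.
Qed.

Lemma in_Obar_coface n x : in_Obar n x -> in_Obar (n + 1) (coface x).
Proof.
move=> /in_ObarP hx; apply/in_ObarP => p t.
have [g ->] := mk_surj t; rewrite cofaceE => /sum_neq0[j].
rewrite !mulf_eq0 !negb_or => /and3P[cc _ /hx <-].
move: cc; case: forallP => [cc _|]; last by rewrite eqxx.
rewrite /tdeg !lmword_mk.
have -> : \sum_(i < m) rowdeg p g i =
  \sum_(i < m) rowdeg p.-1 (fun i k => g i (bump j k)) i.
  apply: eq_bigr => i _; rewrite /rowdeg (lword_mkw_face (j := j)) //.
  by rewrite (eqP (cc _)) letter_eqE.
have -> : p.+1%:Z = p.-1.+1%:Z + 1 by have := ltn_ord j; lia.
by ring.
Qed.

Lemma in_Omega_linext p l d (f : mword m p -> Omega R m p) (x : Omega R m p) :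
  of_degree (@lmword m p) (@lmword m p) d f -> in_Omega l x ->
  in_Omega (l + d) (linext f x).
Proof.
move=> fd hx t; rewrite linextE => /sum_neq0[v].
by rewrite mulf_eq0 negb_or => /andP[/hx <- /fd].
Qed.

Lemma in_Obar_dtot n x : in_Obar n x -> in_Obar (n + 1) (dtot x).
Proof.
move=> hx p t; rewrite dtotE vecD => /addr_neq0[].
  move/(in_Omega_linext (ctr_deg_d (mword_contraction R m p)) (hx p)) => ->.
  by ring.
exact: in_Obar_coface.
Qed.

Lemma grade_homogeneous n x : in_Obar n x -> grade x = (-1) ^ n *: x.
Proof.
move=> /in_ObarP hx; apply: functional_extensionality_dep => p; apply/ffunP => t.
rewrite !obarE ffunE; have [->|/hx ->//] := eqVneq (x p t) 0.
by rewrite !mulr0.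
Qed.

(** * Solving equations degree by degree *)

Definition local_op (G : forall p, Obar R m -> Omega R m p) :=
  forall p x y, (forall q, (q < p)%N -> x q = y q) -> G p x = G p y.

(** Iteration from 0 stabilizes in every component. *)
Lemma local_fixpoint G : local_op G -> exists x, forall p, x p = G p x.
Proof.
move=> Gloc; pose X k : Obar R m := iter k (fun x p => G p x) 0.
have stab k p : (p < k)%N -> X k p = X p.+1 p.
  elim/ltn_ind: p k => p IH [//|k] pk; rewrite /X /=; apply: Gloc => q qp.
  rewrite -/(X k) -/(X p) (IH q qp k); last exact: leq_trans qp pk.
  by rewrite (IH q qp p).
exists (fun p => X p.+1 p) => p; rewrite /X /=; apply: Gloc => q qp.
exact: stab.
Qed.

Definition trunc p x : Obar R m := fun q => if (q < p)%N then x q else 0.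

Lemma truncE p x q : (q < p)%N -> x q = trunc p x q.
Proof. by rewrite /trunc => ->. Qed.

Lemma in_Obar_trunc n p x :
  (forall q, (q < p)%N -> in_Omega (n - q.+1%:Z) (x q)) -> in_Obar n (trunc p x).
Proof.
move=> h q; rewrite /trunc; case: ifP => [/h //|_] t.
by rewrite vec0 eqxx.
Qed.

Definition homotopyO p := linext (@mword_homotopy R m p).
Definition projO p := linext (@mword_proj R m p).
(** The internal differential, the part of dtot which keeps the index. *)
Definition partialO p := linext (@mpartial R m p).

Lemma partialO_D p (x y : Omega R m p) : partialO (x + y) = partialO x + partialO y.
Proof. exact: linextD. Qed.

Lemma partialO_opp p (x : Omega R m p) : partialO (- x) = - partialO x.
Proof. exact: linextN. Qed.

Lemma homotopyO_opp p (x : Omega R m p) : homotopyO (- x) = - homotopyO x.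
Proof. exact: linextN. Qed.

Lemma partialO_B p (x y : Omega R m p) : partialO (x - y) = partialO x - partialO y.
Proof. exact: linextB. Qed.

Lemma homotopy_formula p (x : Omega R m p) :
  partialO (homotopyO x) + homotopyO (partialO x) = x - projO x.
Proof.
rewrite /partialO /homotopyO /projO !linext_comp linext_fadd.
rewrite -{2}[x]linext_id linext_fopp linext_fadd.
by apply: linext_eq => v; apply: (ctr_homotopy (mword_contraction R m p)).
Qed.

Lemma partialO_sq p (x : Omega R m p) : partialO (partialO x) = 0.
Proof.
rewrite /partialO linext_comp; apply: linext_f0 => v.
exact: (ctr_dd (mword_contraction R m p)).
Qed.

(** The homology is concentrated in degree 0. *)
Lemma projO_nonzero_degree p l (x : Omega R m p) :
  in_Omega l x -> l != 0 -> projO x = 0.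
Proof.
move=> hx l0; apply/ffunP => t; rewrite /projO linextE vec0 big1 // => v _.
have [->|/hx vl] := eqVneq (x v) 0; first by rewrite mul0r.
have [->|/(ctr_deg_p (mword_contraction R m p))[v0 _]] :=
  eqVneq (mword_proj R v t) 0; first by rewrite mulr0.
by rewrite -vl v0 eqxx in l0.
Qed.

Lemma in_Omega_homotopyO p l (x : Omega R m p) :
  in_Omega l x -> in_Omega (l - 1) (homotopyO x).
Proof.
exact: (in_Omega_linext (ctr_deg_s (mword_contraction R m p))).
Qed.

End Degrees.

(** * The twisted differential *)

Section TwistedDifferential.
Variables (R : realType) (m : nat) (th w : Obar R m).
Hypotheses (th1 : in_Obar 1 th) (w1 : in_Obar 1 w).
Hypotheses (MCth : dtot th + star th th = 0) (MCw : dtot w + star w w = 0).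

(** For y of degree k, this is the differential of y seen as a morphism between
    the twists of the algebra by w and by th. *)
Definition dtw (k : int) (y : Obar R m) : Obar R m :=
  dtot y + star th y - (-1) ^ k *: star y w.

Lemma dtw_dtw k y : in_Obar k y -> dtw (k + 1) (dtw k y) = 0.
Proof.
move=> hy; rewrite /dtw.
rewrite (dtotD (_ + _)) (dtotD (dtot y)) dtotN dtotZ !dtot_star dtot_dtot.
rewrite (grade_homogeneous th1) (grade_homogeneous hy) signzS expr1z.
rewrite -[dtot th](addrK (star th th)) MCth sub0r.
rewrite -[dtot w](addrK (star w w)) MCw sub0r.
rewrite !(starDl, starDr, starNl, starNr, starZl, starZr) !starA.
rewrite !scalerDr !scalerN !scalerA !mulNr !signz_sq.
by apply: ObarP => n g; rewrite !obarE; ring.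
Qed.

Lemma dtwB k x y : dtw k (x - y) = dtw k x - dtw k y.
Proof.
rewrite /dtw dtotD dtotN starDl starDr starNl starNr.
by apply: ObarP => n g; rewrite !obarE; ring.
Qed.

(** The part of dtw which raises the index. *)
Definition dtw_lower k y : Obar R m := coface y + star th y - (-1) ^ k *: star y w.

Lemma dtw_split k y p : dtw k y p = partialO (y p) + dtw_lower k y p.
Proof. by rewrite /dtw /dtw_lower !obarD dtotE -!addrA. Qed.

Lemma dtw_lower_local k p x y : (forall q, (q < p)%N -> x q = y q) ->
  dtw_lower k x p = dtw_lower k y p.
Proof.
move=> xy; rewrite /dtw_lower !obarE (coface_local xy).
by rewrite (@star_local _ _ th th x y) // (@star_local _ _ x y w w).
Qed.

Lemma dtw_lower0 k : dtw_lower k 0 = 0.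
Proof.
rewrite /dtw_lower star0l star0r scaler0 subr0 addr0.
by have := cofaceZ 0 (0 : Obar R m); rewrite !scale0r.
Qed.

Lemma in_Obar_dtw_lower k y : in_Obar k y -> in_Obar (k + 1) (dtw_lower k y).
Proof.
move=> hy; apply: in_ObarD; last apply/in_ObarN/in_ObarZ/in_Obar_star => //.
by apply: in_ObarD; [apply: in_Obar_coface|rewrite addrC; apply: in_Obar_star].
Qed.

Lemma in_Obar_dtw k y : in_Obar k y -> in_Obar (k + 1) (dtw k y).
Proof.
move=> hy; apply: in_ObarD; last apply/in_ObarN/in_ObarZ/in_Obar_star => //.
by apply: in_ObarD; [apply: in_Obar_dtot|rewrite addrC; apply: in_Obar_star].
Qed.

(** In total degree at most 1 all components of positive index live in
    negative internal degree, where the leading term of the twisted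
    differential is acyclic; so cycles can be killed one component at a time. *)
Lemma dtw_acyclic (n : int) z : n <= 1 -> in_Obar n z -> z 0 = 0 ->
  dtw n z = 0 -> exists2 y, in_Obar (n - 1) y & dtw (n - 1) y = z.
Proof.
move=> n1 hz z0 cz.
have [y ydef] : exists y : Obar R m,
    forall p, y p = homotopyO (z p - dtw_lower (n - 1) y p).
  apply: (local_fixpoint (G := fun p y => homotopyO (z p - dtw_lower (n - 1) y p))).
  by move=> p x y xy; rewrite (dtw_lower_local _ xy).
have hy : in_Obar (n - 1) y.
  move=> p; elim/ltn_ind: p => p IH; rewrite ydef.
  have ht := in_Obar_trunc IH.
  rewrite (dtw_lower_local (n - 1) (fun q => @truncE _ _ p y q)).
  have := in_Obar_dtw_lower ht; rewrite subrK => /in_ObarN hl.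
  have /in_Omega_homotopyO := @in_ObarD _ _ _ _ _ hz hl p.
  by rewrite (_ : n - p.+1%:Z - 1 = n - 1 - p.+1%:Z) //; ring.
exists y => //; pose r := z - dtw (n - 1) y.
suff r0 : r = 0 by apply/esym/eqP; rewrite -subr_eq0 -/r r0.
have hr : in_Obar n r.
  by apply/in_ObarD/in_ObarN => //; have := in_Obar_dtw hy; rewrite subrK.
have dr : dtw n r = 0.
  by rewrite dtwB cz sub0r -{1}(subrK 1 n) dtw_dtw // oppr0.
apply: functional_extensionality_dep => p; rewrite [RHS]obar0.
elim/ltn_ind: p => p IH.
(* The lowest component of the defect r is a cycle. *)
have drp : partialO (r p) = 0.
  have := congr1 (fun x : Obar R m => x p) dr; rewrite dtw_split obar0.
  by rewrite (@dtw_lower_local n p r (0 : Obar R m)) ?dtw_lower0 ?obar0 ?addr0.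
pose c := z p - dtw_lower (n - 1) y p.
have rc : r p = c - partialO (homotopyO c).
  by rewrite /r /c !obarE dtw_split -ydef opprD addrA addrAC.
have dc : partialO c = 0.
  by move: drp; rewrite rc partialO_B partialO_sq subr0.
have -> : r p = projO c.
  have := homotopy_formula c; rewrite dc {2}/homotopyO linext0 addr0 rc => ->.
  by rewrite opprB addrC addrNK.
case: p => [|p] in IH drp c rc dc *.
  rewrite /c z0 (@dtw_lower_local _ 0 y (0 : Obar R m)) // dtw_lower0 subr0.
  exact: linext0.
have hc : in_Omega (n - p.+2%:Z) c.
  have := in_Obar_dtw_lower hy; rewrite subrK => /in_ObarN hl.
  exact: (@in_ObarD _ _ _ _ _ hz hl p.+1).
by apply: (projO_nonzero_degree hc); lia.
Qed.

End TwistedDifferential.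

(** * Symmetric Maurer-Cartan elements *)

Section Existence.
Variables (R : realType) (m : nat).

Definition unit_elt : Omega R m 0 := delta R [tuple [tuple] | i < m].

Lemma unit_eltE t : unit_elt t = 1.
Proof.
have -> : t = [tuple [tuple] | i < m].
  by apply: eq_from_tnth => i; rewrite tnth_mktuple; apply: tuple0.
by rewrite /unit_elt deltaE eqxx.
Qed.

Lemma lword0 (w : word 0) : lword w = 0.
Proof. by rewrite tuple0. Qed.

Lemma lmword0 (t : mword m 0) : lmword t = 0.
Proof. by rewrite /lmword big1 // => i _; rewrite lword0. Qed.

Lemma act_unit_elt s : act_comp s unit_elt = unit_elt.
Proof.
apply/ffunP => t; have [g ->] := mk_surj t.
rewrite act_compE !unit_eltE mulr1 /koszul_form big1 ?expr0z // => i _.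
by rewrite big1 // => j _; rewrite /rowdeg lword0 mul0r.
Qed.

Lemma partialO_index0 (x : Omega R m 0) : partialO x = 0.
Proof.
apply/ffunP => t; have [g ->] := mk_surj t.
by rewrite /partialO linext_mpartialE vec0 big1 // => i _; rewrite big_ord0.
Qed.

Definition avg p (x : Omega R m p) : Omega R m p :=
  #|'S_m|%:R^-1 *: \sum_(s : 'S_m) act_comp s x.

Lemma act_compM p (s s' : 'S_m) (x : Omega R m p) :
  act_comp s' (act_comp s x) = act_comp (s * s')%g x.
Proof.
pose X : Obar R m := fun q =>
  if p =P q is ReflectT e then ecast k (Omega R m k) e x else 0.
have Xp : X p = x by rewrite /X; case: eqP => // e; rewrite eq_axiomK.
have := congr1 (fun y : Obar R m => y p) (Defs.actM s s' X).
by rewrite /Defs.act Xp.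
Qed.

Lemma act_avg p s (x : Omega R m p) : act_comp s (avg x) = avg x.
Proof.
rewrite /avg {1}/act_comp linextZ linext_sum; congr (_ *: _).
rewrite [RHS](reindex_inj (mulIg s)); apply: eq_bigr => s' _.
by rewrite -/(act_comp _ _) act_compM.
Qed.

Lemma avg_fixed p (x : Omega R m p) : (forall s, act_comp s x = x) -> avg x = x.
Proof.
move=> xs; rewrite /avg (eq_bigr (fun=> x)) // sumr_const -scaler_nat scalerA.
rewrite mulVf ?scale1r // pnatr_eq0 -lt0n.
by apply/card_gt0P; exists 1%g.
Qed.

Lemma partialO_avg p (x : Omega R m p) : partialO (avg x) = avg (partialO x).
Proof.
rewrite /partialO /avg linextZ linext_sum; congr (_ *: _).
by apply: eq_bigr => s _; rewrite partial_act.
Qed.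

Lemma avg0 p : avg (0 : Omega R m p) = 0.
Proof. by rewrite /avg big1 ?scaler0 // => s _; apply: linext0. Qed.

Lemma avgB p (x y : Omega R m p) : avg (x - y) = avg x - avg y.
Proof.
rewrite /avg -scalerBr -sumrB; congr (_ *: _); apply: eq_bigr => s _.
exact: linextB.
Qed.

Lemma avgN p (x : Omega R m p) : avg (- x) = - avg x.
Proof. by rewrite -[- x]sub0r avgB avg0 sub0r. Qed.

Lemma in_Omega_avg p l (x : Omega R m p) : in_Omega l x -> in_Omega l (avg x).
Proof.
move=> hx t; rewrite /avg vecZ vec_sum mulf_eq0 negb_or => /andP[_ /sum_neq0[s]].
have [g ->] := mk_surj t; rewrite act_compE mulf_eq0 negb_or => /andP[_ /hx <-].
rewrite !lmword_mk (reindex_inj (@perm_inj _ s)).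
by apply: eq_bigr => i _; rewrite /rowdeg gpermE.
Qed.

(** The curvature dtot w + w * w without its leading term: in index p it only
    involves the components of w of index less than p. *)
Definition curvature_lower (w : Obar R m) : Obar R m := coface w + star w w.

Lemma curvature_lower_local p (x y : Obar R m) :
  (forall q, (q < p)%N -> x q = y q) -> curvature_lower x p = curvature_lower y p.
Proof.
move=> xy; rewrite /curvature_lower !obarD (coface_local xy).
by rewrite (@star_local _ _ x y x y).
Qed.

Lemma in_Obar_curvature_lower (w : Obar R m) :
  in_Obar 1 w -> in_Obar 2 (curvature_lower w).
Proof.
move=> hw; apply: in_ObarD; first exact: (in_Obar_coface hw).
exact: (in_Obar_star hw hw).
Qed.

Lemma bianchi (w : Obar R m) : in_Obar 1 w ->
  dtot (dtot w + star w w) =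
  star (dtot w + star w w) w - star w (dtot w + star w w).
Proof.
move=> hw; rewrite dtotD dtot_dtot dtot_star (grade_homogeneous hw) expr1z.
rewrite !(starDl, starDr, starZl) starA.
by apply: ObarP => n g; rewrite !obarE; ring.
Qed.

Lemma tens_proj_eq (T : finType) (p : T -> Vec R T) n (v v' : n.-tuple T) :
  (forall i, p (tnth v i) = p (tnth v' i)) -> tens_proj p v = tens_proj p v'.
Proof.
elim: n => [|n IH] in v v' *; first by rewrite (tuple0 v) (tuple0 v').
move=> e; rewrite /= (IH _ (behead_tuple v')) => [|i]; last by rewrite !tnth_beheadE.
by congr (tens _ _); exact: (e ord0).
Qed.

(** The only obstruction in degree 0 is the difference of the two vertices
    a...a and c...c of a cube, and these have the same projection. *)
Lemma projO_curvature_lower1 (w : Obar R m) :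
  w 0 = unit_elt -> projO (curvature_lower w 1) = 0.
Proof.
move=> w0; pose A a : mword m 1 := [tuple [tuple a] | i < m].
have -> : curvature_lower w 1 = delta R (A La) - delta R (A Lc).
  apply/ffunP => t; have [g ->] := mk_surj t.
  have eqA a : (mk m 1 g == A a) = [forall i : 'I_m, g i 0 == a].
    apply/eqP/forallP => [/(congr1 (fun t i => tnth (tnth t i) ord0)) e i|e].
      have := congr1 (fun f => f i) e.
      by rewrite tnth_mk tnth_mkw tnth_mktuple => ->.
    apply: eq_from_tnth => i; apply: eq_from_tnth => j.
    by rewrite tnth_mk tnth_mkw tnth_mktuple (ord1 j) (eqP (e i)).
  rewrite /curvature_lower !obarE !deltaE !eqA cofaceE starE !big_ord1 /= w0.
  rewrite !unit_eltE /tdeg lmword0 /cross big1; last first.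
    by move=> i _; rewrite big1 // => k _; rewrite !tnth_mk lword0 mul0r.
  by rewrite !addr0 expr1; ring.
rewrite /projO linextB !linext_delta; apply/eqP; rewrite subr_eq0; apply/eqP.
apply: tens_proj_eq => i; rewrite !tnth_mktuple.
by apply: tens_proj_eq => j; rewrite !(ord1 j).
Qed.

(** The components are built by averaging the solutions that the homotopy gives
    for partial w_p = - curvature_lower w p; the right-hand side is symmetric,
    so the average is a solution as well. *)
Lemma symmetric_universal_MC :
  exists w : Obar R m, universal_MC w /\ symmetric_elt w.
Proof.
pose G p (w : Obar R m) : Omega R m p :=
  match p return Omega R m p -> Omega R m p with
  | 0 => fun _ => unit_elt
  | _ => fun c => avg (homotopyO (- c))
  end (curvature_lower w p).
have [w wdef] : exists w, forall p, w p = G p w.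
  apply: local_fixpoint => p x y xy.
  by rewrite /G (curvature_lower_local xy).
have wS p : w p.+1 = avg (homotopyO (- curvature_lower w p.+1)) by rewrite wdef.
have w0 : w 0 = unit_elt by rewrite wdef.
have ws s : Defs.act s w = w.
  apply: functional_extensionality_dep => -[|p]; rewrite /Defs.act ?w0 ?act_unit_elt //.
  by rewrite wS act_avg.
have hw : in_Obar 1 w.
  move=> p; elim/ltn_ind: p => -[|p] IH.
    by rewrite w0 => t _; rewrite lmword0 subrr.
  have ht := in_Obar_trunc IH.
  rewrite wS (curvature_lower_local (fun q => @truncE _ _ p.+1 w q)).
  apply: in_Omega_avg.
  have := in_Omega_homotopyO (@in_ObarN _ _ _ _ (in_Obar_curvature_lower ht) p.+1).
  by rewrite (_ : 2 - p.+2%:Z - 1 = 1 - p.+2%:Z) //; ring.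
have hN := in_Obar_curvature_lower hw.
have Ns s p : act_comp s (curvature_lower w p) = curvature_lower w p.
  rewrite -[LHS]/(Defs.act s (curvature_lower w) p); congr (_ p).
  by rewrite /curvature_lower actD coface_act act_star ws.
exists w; split; last exact: ws.
split=> //.
(* By the Bianchi identity the lowest component of the curvature is a cycle. *)
pose F := dtot w + star w w.
apply: functional_extensionality_dep => p; rewrite -/F [RHS]obar0.
elim/ltn_ind: p => p IH.
have FE q : F q = partialO (w q) + curvature_lower w q.
  by rewrite /F /curvature_lower !obarD dtotE addrA.
have dF : partialO (F p) = 0.
  have := congr1 (fun x : Obar R m => x p) (bianchi hw); rewrite -/F dtotE obarD obarN.
  rewrite (@coface_local _ _ F (0 : Obar R m)) //.
  rewrite (@star_local _ _ F (0 : Obar R m) w w) //.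
  rewrite (@star_local _ _ w w F (0 : Obar R m)) //.
  by rewrite star0l star0r subrr coface0 addr0.
case: p => [|p] in IH dF *.
  rewrite FE partialO_index0 (@curvature_lower_local 0 w (0 : Obar R m)) //.
  by rewrite /curvature_lower star0l coface0 !addr0.
set N := curvature_lower w p.+1.
have dN : partialO N = 0.
  by have := dF; rewrite FE partialO_D partialO_sq add0r.
have PN : projO N = 0.
  case: p => [|p] in IH dF N dN *; first exact: projO_curvature_lower1.
  by apply: (projO_nonzero_degree (hN _)); lia.
rewrite FE wS partialO_avg -/N homotopyO_opp partialO_opp avgN.
have := homotopy_formula N; rewrite dN PN subr0 {2}/homotopyO linext0 addr0 => ->.
by rewrite avg_fixed ?addNr.
Qed.

End Existence.

(** * Gauge equivalences *)

Section Gauge.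
Variables (R : realType) (m : nat).
Implicit Types (x y z w th a : Obar R m) (u v : uObar R m).

Lemma ustarA u v t : ustar (ustar u v) t = ustar u (ustar v t).
Proof.
case: u v t => [c x] [c' y] [c'' z]; rewrite /ustar /= mulrA; congr pair.
rewrite !(starDl, starDr, starZl, starZr) starA.
by apply: ObarP => n g; rewrite !obarE; ring.
Qed.

Lemma ustar1u u : ustar (uone R m) u = u.
Proof.
by case: u => c x; rewrite /ustar /uone /= mul1r star0l scale1r scaler0 !addr0.
Qed.

Lemma ustaru1 u : ustar u (uone R m) = u.
Proof.
by case: u => c x; rewrite /ustar /uone /= mulr1 star0r scale1r scaler0 add0r addr0.
Qed.

Lemma ustarBl u u' v : ustar (u - u') v = ustar u v - ustar u' v.
Proof.
case: u u' v => [c x] [c' y] [c'' z]; rewrite /ustar; apply/pair_equal_spec => /=; split.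
  exact: mulrBl.
rewrite !(starDl, starNl); apply: ObarP => n g; rewrite !obarE /=.
(* The scalars of the unital extension live in R^o; ring needs them in R. *)
change (((c - c') * z n (mk m n g) + c'' * (x n (mk m n g) - y n (mk m n g)) +
  (star x z n (mk m n g) - star y z n (mk m n g)) : R) =
  (c * z n (mk m n g) + c'' * x n (mk m n g) + star x z n (mk m n g)) -
  (c' * z n (mk m n g) + c'' * y n (mk m n g) + star y z n (mk m n g))).
ring.
Qed.

(** The equations for a right and for a left inverse can be solved recursively,
    and associativity identifies the two solutions. *)
Lemma uone_inv x : exists v, ustar (uone R m + uin x) v = uone R m /\
                             ustar v (uone R m + uin x) = uone R m.
Proof.
have [y ydef] : exists y, forall p, y p = (- x - star x y) p.
  apply: local_fixpoint => p y y' yy; rewrite !obarE.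
  by rewrite (@star_local _ _ x x y y').
have [z zdef] : exists z, forall p, z p = (- x - star z x) p.
  apply: local_fixpoint => p z z' zz; rewrite !obarE.
  by rewrite (@star_local _ _ z z' x x).
have {}ydef : y = - x - star x y by apply: functional_extensionality_dep.
have {}zdef : z = - x - star z x by apply: functional_extensionality_dep.
set u := uone R m + uin x.
have uE : u = (1, x).
  by rewrite /u /uone /uin; apply/pair_equal_spec; rewrite /= addr0 add0r.
have uy : ustar u (1, y) = uone R m.
  rewrite uE /ustar /uone /= mulr1 !scale1r; congr pair.
  by rewrite {1}ydef; apply: ObarP => n g; rewrite !obarE; ring.
have zu : ustar (1, z) u = uone R m.
  rewrite uE /ustar /uone /= mulr1 !scale1r; congr pair.
  by rewrite {1}zdef; apply: ObarP => n g; rewrite !obarE; ring.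
exists (1, y); split=> //.
suff -> : (1, y) = (1, z) :> uObar R m by [].
by rewrite -[LHS]ustar1u -zu ustarA uy ustaru1.
Qed.

(** Multiplying the gauge equation by u makes it linear in u. *)
Lemma strong_gaugeP w th u : strong_gauge w th u <->
  exists2 a, in_Obar 0 a & u = uone R m + uin a /\ dtw th w 0 a = w - th.
Proof.
have prods a : [/\ ustar (uone R m + uin a) (uin w) = uin (w + star a w),
    ustar (uin th) (uone R m + uin a) = uin (th + star th a)
  & udtot (uone R m + uin a) = uin (dtot a)].
  have -> : uone R m + uin a = (1, a).
    by apply/pair_equal_spec; rewrite /= addr0 add0r.
  split.
  - by rewrite /ustar /uin /= mulr0 scale1r scale0r addr0.
  - by rewrite /ustar /uin /= mul0r scale0r scale1r add0r.
  - by [].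
have lin a : uin (w + star a w) - uin (th + star th a) = uin (dtot a) <->
    dtw th w 0 a = w - th.
  rewrite /uin /dtw expr0z scale1r.
  split=> [/(congr1 snd) /= <-|e]; first by apply: ObarP => n g; rewrite !obarE; ring.
  apply/pair_equal_spec; rewrite /= subr0; split=> //.
  have -> : dtot a = (w - th) - star th a + star a w.
    by rewrite -e; apply: ObarP => n g; rewrite !obarE; ring.
  by apply: ObarP => n g; rewrite !obarE; ring.
split=> [[[a ha ->] [u' [uu' u'u e]]]|[a ha [-> e]]].
  exists a => //; split=> //; apply/lin; have [<- <- <-] := prods a.
  have := congr1 (fun v => ustar v (uone R m + uin a)) e.
  by rewrite ustarBl !ustarA u'u !ustaru1.
split; first by exists a.
have [u' [uu' u'u]] := uone_inv a; exists u'; split=> //.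
have [-> p2 ->] := prods a; rewrite -(proj2 (lin a) e) -p2.
by rewrite ustarBl ustarA uu' ustaru1.
Qed.

(** The difference of two Maurer-Cartan elements is a cycle of degree 1 whose
    first component vanishes, because both start with e [x] ... [x] e. *)
Lemma universal_MC_gauge w th : universal_MC w -> universal_MC th ->
  exists u, strong_gauge w th u.
Proof.
case=> w1 w0 MCw [th1 th0 MCth].
have cyc : dtw th w 1 (w - th) = 0.
  rewrite /dtw dtotD dtotN expr1z !(starDl, starDr, starNl, starNr).
  rewrite -[dtot w](addrK (star w w)) MCw -[dtot th](addrK (star th th)) MCth.
  by apply: ObarP => n g; rewrite !obarE; ring.
have z0 : (w - th) 0 = 0 by rewrite obarD obarN w0 th0 subrr.
have [a ha ea] := dtw_acyclic th1 w1 MCth MCw (lexx 1)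
  (in_ObarD w1 (in_ObarN th1)) z0 cyc.
exists (uone R m + uin a); apply/strong_gaugeP; exists a => //.
Qed.

(** The difference of two solutions of the linear equation is a cycle of degree
    0; its first component has degree -1 in Omega_m^1, which is concentrated in
    degree 0. *)
Lemma strong_gauge_homotopic w th u u' : universal_MC w -> universal_MC th ->
  strong_gauge w th u -> strong_gauge w th u' -> homotopic w th u u'.
Proof.
case=> w1 w0 MCw [th1 th0 MCth] /strong_gaugeP[a ha [-> ea]] /strong_gaugeP[b hb [-> eb]].
have cyc : dtw th w 0 (a - b) = 0 by rewrite dtwB ea eb subrr.
have hab := in_ObarD ha (in_ObarN hb).
have z0 : (a - b) 0 = 0.
  apply/ffunP => t; apply/eqP; rewrite vec0; apply/negP => /negP /hab.
  by rewrite lmword0.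
have [h hh eh] := dtw_acyclic th1 w1 MCth MCw (@ler01 int) hab z0 cyc.
exists h => //.
have -> : dtot h + star h w + star th h = a - b.
  by rewrite -eh /dtw exprN1 invrN invr1; apply: ObarP => n g; rewrite !obarE; ring.
by apply/pair_equal_spec; rewrite /=; split; [rewrite !addr0 subrr | rewrite !add0r].
Qed.

End Gauge.

Theorem theorem5p6 (R : realType) (m : nat) (hm : (0 < m)%N) :
  (exists w : Obar R m, universal_MC w /\ symmetric_elt w) /\
  (forall w th : Obar R m, universal_MC w -> universal_MC th ->
     (exists u : uObar R m, strong_gauge w th u) /\
     (forall u u' : uObar R m, strong_gauge w th u -> strong_gauge w th u' ->
        homotopic w th u u')).
Proof.
split; first exact: symmetric_universal_MC.
move=> w th MCw MCth; split; first exact: universal_MC_gauge.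
by move=> u u'; apply: strong_gauge_homotopic.
Qed.
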